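(* Let $V$ be a complex vector space of dimension $r$, let $\alpha=(\alpha_1,\dots,\alpha_r)$ be a partition and $r_\alpha=\dim\mathbf{S}^\alpha V$. For $k=2,3$ let $f^{(k)}_{\mathbf{S}^\alpha V}(r)\in\mathbb{Q}$ be the scalar with $\mathsf{d}_k(\mathbf{S}^\alpha V)=f^{(k)}_{\mathbf{S}^\alpha V}(r)\,\mathsf{d}_k(V)$. (1) If $r\ge2$, then $$f^{(2)}_{\mathbf{S}^\alpha V}(r)=\frac{\dot\delta_r^{(2)}(\alpha)}{(r-1)(r+1)}\,\frac{r_\alpha}{r},$$ where $$\dot\delta_r^{(2)}(\alpha)=(r-1)\sum_{i=1}^r\alpha_i^2-2\sum_{1\le i<j\le r}\alpha_i\alpha_j+r\sum_{i=1}^r(r+1-2i)\alpha_i.$$ (2) If $r\ge3$, then $$f^{(3)}_{\mathbf{S}^\alpha V}(r)=\frac{\dot\delta_r^{(3)}(\alpha)}{(r-2)(r-1)(r+1)(r+2)}\,\frac{r_\alpha}{r},$$ where $$\dot\delta_r^{(3)}(\alpha)=2(r-2)(r-1)\sum_{i=1}^r\alpha_i^3-6(r-2)\sum_{1\le i\ne j\le r}\alpha_i^2\alpha_j+24\sum_{1\le i<j<k\le r}\alpha_i\alpha_j\alpha_k+3r(r-2)\sum_{i=1}^r(r+1-2i)\alpha_i^2-12r\sum_{1\le i<j\le r}(r+1-i-j)\alpha_i\alpha_j+r^2\sum_{i=1}^r\bigl(6i^2-6i(r+1)+r^2+3r+2\bigr)\alpha_i.$$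
   Context: A partition is a sequence of integers $\alpha_1\ge\dots\ge\alpha_r\ge0$; $\mathbf{S}^\alpha V$ is the irreducible polynomial representation of $\mathrm{GL}(V)$ of highest weight $\alpha$. The sum over $i\ne j$ is over ordered pairs. For a polynomial representation $W$ of $\mathrm{GL}_r=\mathrm{GL}(V)$ with weight spaces $W(\lambda)$, $\lambda\in\mathbb{N}^r$, for the diagonal torus, the Chern character is $\mathrm{ch}(W)=\sum_\lambda\dim W(\lambda)\,e^{\lambda_1a_1+\dots+\lambda_ra_r}\in\mathbb{Q}[[a_1,\dots,a_r]]$, and $\mathrm{ch}_k(W)$ is its homogeneous part of degree $k$ (so $\mathrm{ch}_0(W)=\dim W$). Set $\Delta_2(W)=\mathrm{ch}_1(W)^2-2\mathrm{ch}_0(W)\mathrm{ch}_2(W)$, $\Delta_3(W)=\mathrm{ch}_1(W)^3-3\mathrm{ch}_0(W)\mathrm{ch}_1(W)\mathrm{ch}_2(W)+3\mathrm{ch}_0(W)^2\mathrm{ch}_3(W)$, and $\mathsf{d}_k(W)=\dfrac{\Delta_k(W)}{k\,\mathrm{ch}_0(W)^{k-1}}$. It is known that for $k=2,3$ the polynomial $\mathsf{d}_k(\mathbf{S}^\alpha V)$ is a rational multiple of $\mathsf{d}_k(V)$; for $r\ge k$ one has $\mathsf{d}_k(V)\ne0$, so the multiple is unique. *)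

(* Defs.v *)
From HB Require Import structures.
From mathcomp Require Import all_boot all_order all_algebra.
From mathcomp Require Import boolp classical_sets fsbigop reals.
From mathcomp Require Import complex.
From mathcomp Require Import mpoly.

Set Implicit Arguments.
Unset Strict Implicit.
Unset Printing Implicit Defensive.

Import Order.TTheory GRing.Theory Num.Theory.
Local Open Scope ring_scope.

Section Representations.
Context {C : fieldType} {r : nat} {W : vectType C}.

(* A representation of GL_r on W is given by a map on all r x r matrices of
   which only the values on invertible matrices matter. *)
Implicit Type rho : 'M[C]_r -> 'End(W).

Record polynomial_rep rho : Prop := PolynomialRep {
  polynomial_rep1 : rho 1%:M = \1%VF;
  polynomial_repM : forall g h, g \in unitmx -> h \in unitmx ->
    rho (g *m h) = (rho g \o rho h)%VF;
  polynomial_rep_coef : forall (phi : 'Hom(W, C^o)) (w : W),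
    exists p : {mpoly C[r * r]}, forall g, g \in unitmx ->
      phi (rho g w) = p.@[fun k => mxvec g 0 k]
}.

Definition irreducible_rep rho : Prop :=
  \dim {: W} != 0%N /\
  forall U : {vspace W},
    (forall g, g \in unitmx -> (rho g @: U <= U)%VS) ->
    U = 0%VS \/ U = fullv.

Definition is_weight_vector rho (l : 'X_{1..r}) (w : W) : Prop :=
  forall t : 'rV[C]_r, (forall i, t 0 i != 0) ->
    rho (diag_mx t) w = (\prod_i t 0 i ^+ l i) *: w.

(* The choice is determined: see [mem_weight_space]. *)
Definition weight_space rho (l : 'X_{1..r}) : {vspace W} :=
  xget 0%VS [set U : {vspace W} |
    forall w, w \in U <-> is_weight_vector rho l w]%classic.

Lemma mem_weight_space rho l w :
  w \in weight_space rho l <-> is_weight_vector rho l w.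
Proof.
rewrite /weight_space; case: xgetP => [U _ /(_ w) //|/= noU]; exfalso.
pose P (n : nat) := `[< exists U : {vspace W},
  \dim U = n /\ forall w, w \in U -> is_weight_vector rho l w >].
have P0 : exists n, P n.
  exists 0%N; apply/asboolP; exists 0%VS; rewrite dimv0; split=> // x.
  by rewrite memv0 => /eqP-> t _; rewrite linear0 scaler0.
have Pub n : P n -> (n <= \dim {: W})%N.
  by move=> /asboolP[U [<- _]]; apply/dimvS/subvf.
case: (ex_maxnP P0 Pub) => n /asboolP[U [dimU wtU]] maxn.
apply: (noU U) => x; split=> [/wtU //|wtx].
suff -> : U = (U + <[x]>)%VS by apply: (subvP (addvSr U _)); apply: memv_line.
apply/eqP; rewrite eqEdim addvSl /= dimU; apply: maxn; apply/asboolP.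
exists (U + <[x]>)%VS; split=> // y /memv_addP[u uU [v /vlineP[c ->] ->]] t t0.
by rewrite linearD linearZ /= (wtU _ uU t t0) (wtx t t0) scalerDr !scalerA mulrC.
Qed.

(* Highest weight with respect to the Borel subgroup of upper triangular
   matrices; [is_trig_mx] means lower triangular. *)
Definition has_highest_weight rho (l : 'X_{1..r}) : Prop :=
  exists w : W, [/\ w != 0, w \in weight_space rho l &
    forall u : 'M[C]_r, is_trig_mx u^T -> (forall i, u i i = 1) ->
      rho u w = w].

(* The degree k part of the Chern character: the degree k part of the power
   series exp(x), for a linear form x, is x ^+ k / k!.  The sum has finite
   support, since W is the direct sum of its weight spaces. *)
Definition ch rho (k : nat) : {mpoly rat[r]} :=
  \sum_(l \in [set: 'X_{1..r}]%classic)
    ((\dim (weight_space rho l))%:R / (k`!)%:R : rat) *: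
    (\sum_(i < r) (l i)%:R *: 'X_i) ^+ k.

Definition Delta2 rho : {mpoly rat[r]} :=
  ch rho 1 ^+ 2 - 2%:R * ch rho 0 * ch rho 2.

Definition Delta3 rho : {mpoly rat[r]} :=
  ch rho 1 ^+ 3 - 3%:R * ch rho 0 * ch rho 1 * ch rho 2
  + 3%:R * ch rho 0 ^+ 2 * ch rho 3.

(* [ch rho 0] is a constant polynomial; this is its value. *)
Definition ch0 rho : rat := (ch rho 0)@_0%MM.

Definition d2 rho : {mpoly rat[r]} := (2%:R * ch0 rho)^-1 *: Delta2 rho.

Definition d3 rho : {mpoly rat[r]} := (3%:R * ch0 rho ^+ 2)^-1 *: Delta3 rho.

End Representations.

(* The tautological representation of GL(V), V = C^r. *)
Definition std (C : fieldType) (r : nat) (g : 'M[C]_r) : 'End('cV[C]_r) :=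
  linfun (mulmx g).
Arguments std : clear implicits.

Definition is_partition (r : nat) (a : 'X_{1..r}) : Prop :=
  forall i j : 'I_r, (i <= j)%N -> (a j <= a i)%N.

(* Below the index i : 'I_r, which starts at 0, stands for the index i.+1. *)
Section DeltaDot.
Variables (r : nat) (a : 'X_{1..r}).
Let R : rat := r%:R.
Let A (i : 'I_r) : rat := (a i)%:R.
Let I (i : 'I_r) : rat := (i.+1)%:R.

Definition delta_dot2 : rat :=
  (R - 1) * (\sum_(i < r) A i ^+ 2)
  - 2%:R * (\sum_(i < r) \sum_(j < r | (i < j)%N) A i * A j)
  + R * (\sum_(i < r) (R + 1 - 2%:R * I i) * A i).

Definition delta_dot3 : rat :=
  2%:R * (R - 2%:R) * (R - 1) * (\sum_(i < r) A i ^+ 3)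
  - 6%:R * (R - 2%:R) * (\sum_(i < r) \sum_(j < r | i != j) A i ^+ 2 * A j)
  + 24%:R * (\sum_(i < r) \sum_(j < r | (i < j)%N) \sum_(k < r | (j < k)%N)
               A i * A j * A k)
  + 3%:R * R * (R - 2%:R) * (\sum_(i < r) (R + 1 - 2%:R * I i) * A i ^+ 2)
  - 12%:R * R * (\sum_(i < r) \sum_(j < r | (i < j)%N)
                   (R + 1 - I i - I j) * A i * A j)
  + R ^+ 2 * (\sum_(i < r)
      (6%:R * I i ^+ 2 - 6%:R * I i * (R + 1) + R ^+ 2 + 3%:R * R + 2%:R) * A i).

End DeltaDot.

(* Main.v *)
Require Import Defs.
From HB Require Import structures.
From mathcomp Require Import all_boot all_order all_algebra all_fingroup.
From mathcomp Require Import boolp classical_sets fsbigop reals complex mpoly.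
From mathcomp Require Import ring zify.

(** Both scalars are traces in disguise.  Differentiating [rho] at the identity
    gives operators [e i j], the images of the matrix units, which satisfy the
    commutation rules of [gl_r]; on the weight space of weight [m] the operator
    [e i i] is multiplication by [m i].  Hence the power moments
      [\sum_m dim W(m) * m i * m j * ...]
    of the weights, which are the coefficients of the Chern character, are the
    traces of the products [e i i *m e j j *m ...] ([mxtrace_moment2],
    [mxtrace_moment3]).

    Permutation matrices conjugate these operators into each other, so a moment
    depends only on which of its indices coincide: the quadratic moments are
    [b + d * (i == j)] and the cubic ones
    [A + B * ((i == j) + (j == k) + (i == k)) + E * (i == j) * (j == k)].
    Substituting this into the definitions gives, for every representation with
    such moments, the coefficients of [d2 rho] and [d3 rho] on the products of
    power sums ([d2_pattern], [d3_pattern]); comparing with the tautological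
    representation, for which [d = E = 1], the two scalars are [d] and [E].

    Three central elements determine these numbers.  A central element acts on
    an irreducible representation by the scalar by which it acts on the highest
    weight vector ([commuting_scalar]); there are the Euler element
    [\sum_i e i i], with scalar [|alpha|], and the two Casimir elements
    [\sum_(i, j) e i j *m e j i] and
    [\sum_(i, j, k) e i j *m e j k *m e k i], whose scalars come out of the
    commutation rules ([acts_by_casimir_step]).  Conversely, invariance of the
    trace expresses the traces of all these products through the moments
    ([mxtrace_quadratic], [mxtrace_cubic]).  Equating the two computations
    gives linear equations whose solution is [d] and [E]
    ([solve_quadratic], [solve_cubic]), and a computation with power sums
    identifies the right-hand sides with [delta_dot2] and [delta_dot3]
    ([delta_dot2_casimir], [delta_dot3_casimir]). *)

Set Implicit Arguments.
Unset Strict Implicit.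
Unset Printing Implicit Defensive.

Import Order.TTheory GRing.Theory Num.Theory.
Local Open Scope ring_scope.

(** * Polynomial identities over an infinite field *)

Section PolynomialIdentities.
Variable C : numFieldType.

Lemma poly_eq_off_roots (d p q : {poly C}) :
  d != 0 -> (forall t, d.[t] != 0 -> p.[t] = q.[t]) -> p = q.
Proof.
move=> d0 eqpq; apply/eqP; rewrite -subr_eq0; apply: contraTT isT => pq0.
have nz : (p - q) * d != 0 by rewrite mulf_neq0.
pose s := [seq n%:R : C | n <- iota 0 (size ((p - q) * d))].
have := @max_poly_roots _ _ s nz; rewrite size_map size_iota ltnn; apply.
- apply/allP=> t _; rewrite /root hornerM.
  have [->|/eqpq] := eqVneq d.[t] 0; first by rewrite mulr0.
  by rewrite hornerD hornerN => ->; rewrite subrr mul0r.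
- by rewrite map_inj_uniq ?iota_uniq // => i j /eqP; rewrite eqr_nat => /eqP.
Qed.

(** Uniqueness of base [B] digits; it makes the exponents in Kronecker's
    substitution distinct. *)
Lemma digits_inj (B r : nat) (f g : nat -> nat) :
  (forall i, f i < B)%N -> (forall i, g i < B)%N ->
  (\sum_(i < r) f i * B ^ i = \sum_(i < r) g i * B ^ i)%N ->
  forall i, (i < r)%N -> f i = g i.
Proof.
elim: r f g => // r IH f g fB gB.
rewrite !big_ord_recl !expn0 !muln1.
have shift h : (\sum_(i < r) h (bump 0 i) * B ^ bump 0 i =
    (\sum_(i < r) h i.+1 * B ^ i) * B)%N.
  by rewrite big_distrl; apply: eq_bigr => i _; rewrite /= expnSr mulnA.
rewrite !shift => eq_sum.
have eq0 : f 0%N = g 0%N.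
  have := congr1 (modn^~ B) eq_sum.
  by rewrite /= ![(_ 0%N + _)%N]addnC !modnMDl !modn_small.
have B0 : (0 < B)%N by apply: leq_ltn_trans (fB 0%N).
move/eqP: eq_sum; rewrite eq0 eqn_add2l eqn_pmul2r // => /eqP eqS [|i] //.
by apply: (IH (f \o S) (g \o S)) => // i'; [apply: fB | apply: gB].
Qed.

(** Kronecker's substitution [t i = u ^+ (B ^ i)] separates the monomials of
    degree less than [B], and turns the claim into the one-variable case. *)
Lemma mpoly_eq_on_torus (r : nat) (p q : {mpoly C[r]}) :
  (forall t : 'I_r -> C, (forall i, t i != 0) -> p.@[t] = q.@[t]) -> p = q.
Proof.
move=> eqpq; apply/eqP; rewrite -subr_eq0; apply/eqP.
set T := p - q; pose B := msize T.
pose e (m : 'X_{1..r}) := (\sum_(i < r) m i * B ^ i)%N.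
pose k := \sum_(m <- msupp T) T@_m *: 'X^(e m) : {poly C}.
have k0 : k = 0.
  apply: (@poly_eq_off_roots 'X) => [|u]; first by rewrite polyX_eq0.
  rewrite hornerX horner0 => u0.
  have -> : k.[u] = T.@[fun i : 'I_r => u ^+ (B ^ i)].
    rewrite mevalE horner_sum; apply: eq_bigr => m _.
    rewrite hornerZ hornerXn /e -prodrXr; congr (_ * _).
    by apply: eq_bigr => i _; rewrite mulnC exprM.
  by rewrite mevalB eqpq ?subrr // => i; rewrite expf_neq0.
have mB (m : 'X_{1..r}) (i : 'I_r) : m \in msupp T -> (m i < B)%N.
  move/msize_mdeg_lt; apply: leq_ltn_trans.
  by rewrite mdegE (bigD1 i) //= leq_addr.
apply/mpolyP => m; rewrite mcoeff0; apply: contra_eq k0 => Tm.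
have mT : m \in msupp T by rewrite mcoeff_msupp.
have B0 : (0 < B)%N by apply: leq_ltn_trans (msize_mdeg_lt mT).
apply: contra_neq Tm => k0; have := congr1 (fun f : {poly C} => f`_(e m)) k0.
rewrite coef0 coef_sum (bigD1_seq m) ?msupp_uniq //=.
rewrite coefZ coefXn eqxx mulr1 big_seq_cond big1 ?addr0 // => m' /andP[m'T m'm].
rewrite coefZ coefXn; case: eqP => [eqe|_]; last by rewrite mulr0.
case/eqP: m'm; apply/mnmP => i.
(* [digits_inj] wants digit sequences defined on all of [nat]. *)
pose ext (n : 'X_{1..r}) j := if insub j is Some j' then n j' else 0%N : nat.
have extE n (j : 'I_r) : ext n j = n j by rewrite /ext valK.
have extB n : n \in msupp T -> forall j, (ext n j < B)%N.
  by move=> nT j; rewrite /ext; case: insubP => // j' _ _; apply: mB.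
rewrite -!extE; apply: (@digits_inj B r) (ltn_ord i); try exact: extB.
by under eq_bigr do rewrite extE; under [RHS]eq_bigr do rewrite extE.
Qed.

Lemma coef1_expr1DX k : ((1 + 'X : {poly C}) ^+ k)`_1 = k%:R.
Proof.
rewrite -[LHS]mulr1n -coef_deriv deriv_exp derivD derivC derivX add0r mul1r.
by rewrite coefMn -horner_coef0 horner_exp hornerD hornerC hornerX addr0 expr1n.
Qed.

Variable N : nat.
Implicit Types (p q : {mpoly C[N]}) (g x : 'I_N -> C).

Definition along_line p g x : {poly C} :=
  mmap polyC (fun k => (g k)%:P + x k *: 'X) p.

Lemma along_lineE p g x t : (along_line p g x).[t] = p.@[fun k => g k + x k * t].
Proof.
rewrite /along_line mevalE /mmap horner_sum; apply: eq_bigr => m _.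
rewrite hornerM hornerC /mmap1 horner_prod; congr (_ * _); apply: eq_bigr => i _.
by rewrite horner_exp hornerD hornerC hornerZ hornerX.
Qed.

Lemma along_line_coef0 p g x : (along_line p g x)`_0 = p.@[g].
Proof.
rewrite -horner_coef0 along_lineE; apply: meval_eq => k.
by rewrite mulr0 addr0.
Qed.

(** The chain rule at [t = 0].  Both sides are derivations at [g] in the
    argument [p], so it is enough to compare them on the variables. *)
Lemma along_line_coef1 p g x :
  (along_line p g x)`_1 = \sum_k x k * p^`M(k).@[g].
Proof.
pose K p := (along_line p g x)`_1 = \sum_k x k * p^`M(k).@[g].
have K0 c : K c%:MP.
  rewrite /K /along_line mmapC coefC /= big1 // => k _.
  by rewrite mderivC meval0 mulr0.
have KD p1 p2 : K p1 -> K p2 -> K (p1 + p2).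
  rewrite /K /along_line mmapD coefD => -> ->; rewrite -big_split /=.
  by apply: eq_bigr => k _; rewrite mderivD mevalD mulrDr.
have KM p1 p2 : K p1 -> K p2 -> K (p1 * p2).
  rewrite /K {3}/along_line rmorphM => K1 K2.
  rewrite coefM big_ord_recl big_ord1 /= subn0 subnn -!/(along_line _ _ _).
  rewrite !along_line_coef0 K1 K2 mulr_sumr mulr_suml -big_split /=.
  apply: eq_bigr => k _; rewrite mderivM mevalD !mevalM; ring.
have KX i : K 'X_i.
  rewrite /K /along_line mmapX mmap1U coefD coefC coefZ coefX /= mulr1 add0r.
  rewrite (bigD1 i) //= mderivX mnm1E eqxx scale1r.
  rewrite -{1}[U_(i)%MM]add0m addmK mpolyX0 meval1 mulr1.
  rewrite big1 ?addr0 // => k ki.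
  by rewrite mderivX mnm1E eq_sym (negPf ki) scale0r meval0 mulr0.
elim/mpolyind: p => [|c m p _ _ IH]; first exact: (K0 0).
apply: (KD) IH; rewrite -mul_mpolyC; apply: (KM); first exact: K0.
rewrite mpolyXE_id; elim/big_rec: _ => [|i q _ Kq]; first exact: (K0 1).
apply: (KM) => //; elim: (m i) => [|j IH]; first exact: (K0 1).
by rewrite exprS; apply: KM.
Qed.

End PolynomialIdentities.

(** * The differential of a polynomial representation and Casimir elements *)

Section MatrixRep.
Variables (C : numFieldType) (r n : nat) (Q : 'M[{mpoly C[r * r]}]_n).
Implicit Types (g X Y Z : 'M[C]_r).

(** The operator attached to [g] by a matrix [Q] of polynomials in the entries
    of [g]; [Q] stands for a representation written in coordinates. *)
Definition value g : 'M[C]_n := map_mx (meval (mxvec g 0)) Q.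

Definition deriv_at g X : 'M[C]_n :=
  \sum_k mxvec X 0 k *: map_mx (fun q => q^`M(k).@[mxvec g 0]) Q.

(** The representation of the Lie algebra [gl_r] on the same space. *)
Definition dvalue X : 'M[C]_n := deriv_at 1%:M X.

Lemma dvalue_is_linear : linear dvalue.
Proof.
move=> c X Y; rewrite /dvalue /deriv_at scaler_sumr -big_split /=.
by apply: eq_bigr => k _; rewrite linearP !mxE scalerDl scalerA.
Qed.

HB.instance Definition _ :=
  GRing.isLinear.Build C 'M[C]_r 'M[C]_n _ dvalue dvalue_is_linear.

Definition line_mx g X : 'M[{poly C}]_n :=
  map_mx (fun q => along_line q (mxvec g 0) (mxvec X 0)) Q.

Lemma horner_line_mx g X t a b :
  (line_mx g X a b).[t] = value (g + t *: X) a b.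
Proof.
rewrite !mxE along_lineE; apply: meval_eq => k.
by rewrite linearD linearZ /= !mxE mulrC.
Qed.

Lemma coef0_line_mx g X a b : (line_mx g X a b)`_0 = value g a b.
Proof. by rewrite !mxE along_line_coef0. Qed.

Lemma coef1_line_mx g X a b : (line_mx g X a b)`_1 = deriv_at g X a b.
Proof.
rewrite !mxE along_line_coef1 summxE.
by apply: eq_bigr => k _; rewrite !mxE.
Qed.

(** Multiplicativity is only known on invertible matrices.  This provides enough
    of them on each line through the identity to identify polynomials in [t]. *)
Lemma unit_near_1 X : exists2 d : {poly C}, d != 0 &
  forall t, d.[t] != 0 -> 1%:M + t *: X \in unitmx.
Proof.
pose d := \det (1%:M + 'X *: map_mx polyC X).
have dE t : d.[t] = \det (1%:M + t *: X).
  rewrite -/(horner_eval t d) -det_map_mx; congr (\det _); apply/matrixP => i j.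
  by rewrite !mxE rmorphD rmorphM rmorph_nat /= /horner_eval hornerX hornerC.
exists d => [|t]; last by rewrite dE unitmxE unitfE.
apply/eqP => d0; have := dE 0; rewrite d0 horner0 scale0r addr0 det1 => /eqP.
by rewrite eq_sym oner_eq0.
Qed.

Hypothesis value1 : value 1%:M = 1%:M.
Hypothesis valueM : forall g h, g \in unitmx -> h \in unitmx ->
  value (g *m h) = value g *m value h.

(** First-order part of [value (g *m (1 + t X)) = value g *m value (1 + t X)]. *)
Lemma mul_value_dvalue g X : g \in unitmx ->
  value g *m dvalue X = deriv_at g (g *m X).
Proof.
move=> gU; apply/matrixP => a b; rewrite mxE -coef1_line_mx.
have [d d0 dU] := unit_near_1 X.
have -> : line_mx g (g *m X) a b =
    \sum_c (value g a c)%:P * line_mx 1%:M X c b.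
  apply: (poly_eq_off_roots d0) => t dt.
  rewrite horner_line_mx horner_sum.
  have -> : g + t *: (g *m X) = g *m (1%:M + t *: X).
    by rewrite mulmxDr mulmx1 scalemxAr.
  rewrite (valueM gU (dU t dt)) mxE; apply: eq_bigr => c _.
  by rewrite hornerM hornerC horner_line_mx.
by rewrite coef_sum; apply: eq_bigr => c _; rewrite coefCM coef1_line_mx.
Qed.

Lemma mul_dvalue_value g X : g \in unitmx ->
  dvalue X *m value g = deriv_at g (X *m g).
Proof.
move=> gU; apply/matrixP => a b; rewrite mxE -coef1_line_mx.
have [d d0 dU] := unit_near_1 X.
have -> : line_mx g (X *m g) a b =
    \sum_c line_mx 1%:M X a c * (value g c b)%:P.
  apply: (poly_eq_off_roots d0) => t dt.
  rewrite horner_line_mx horner_sum.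
  have -> : g + t *: (X *m g) = (1%:M + t *: X) *m g.
    by rewrite mulmxDl mul1mx scalemxAl.
  rewrite (valueM (dU t dt) gU) mxE; apply: eq_bigr => c _.
  by rewrite hornerM hornerC horner_line_mx.
by rewrite coef_sum; apply: eq_bigr => c _; rewrite coefMC coef1_line_mx.
Qed.

(** For invertible [g] this says that [value g] conjugates [S X] into
    [S (g *m X *m invmx g)].  Avoiding the inverse keeps both sides polynomial
    in [g], so that the relation can be differentiated. *)
Definition equivariant (S : 'M[C]_r -> 'M[C]_n) := forall g X, g \in unitmx ->
  value g *m S (X *m g) = S (g *m X) *m value g.

Lemma dvalue_equivariant : equivariant dvalue.
Proof.
by move=> g X gU; rewrite mul_value_dvalue // mul_dvalue_value // mulmxA.
Qed.

(** First-order part of the equivariance of [S] along [1 + t Y].  For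
    [S = dvalue] these are the commutation rules of [gl_r]. *)
Lemma equivariant_bracket (S : {linear 'M[C]_r -> 'M[C]_n}) X Y :
  equivariant S ->
  dvalue Y *m S X = S X *m dvalue Y + S (Y *m X) - S (X *m Y).
Proof.
move=> eqS; apply/eqP; rewrite eq_sym subr_eq eq_sym; apply/eqP.
apply/matrixP => a b; rewrite !mxE.
have [d d0 dU] := unit_near_1 Y.
have : \sum_c line_mx 1%:M Y a c * ((S X c b)%:P + 'X * (S (X *m Y) c b)%:P) =
       \sum_c ((S X a c)%:P + 'X * (S (Y *m X) a c)%:P) * line_mx 1%:M Y c b.
  apply: (poly_eq_off_roots d0) => t dt.
  have : value (1%:M + t *: Y) *m (S X + t *: S (X *m Y)) =
         (S X + t *: S (Y *m X)) *m value (1%:M + t *: Y).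
    have := eqS _ X (dU t dt).
    rewrite mulmxDr mulmxDl mulmx1 mul1mx -scalemxAr -scalemxAl.
    by rewrite !linearD !linearZ.
  move=> /matrixP/(_ a b); rewrite !mxE !horner_sum => eqS_ab.
  have hornerE2 (A B : 'M[C]_n) x y :
      ((A x y)%:P + 'X * (B x y)%:P).[t] = (A + t *: B) x y.
    by rewrite hornerD hornerM hornerX !hornerC !mxE.
  under eq_bigr => c _ do rewrite hornerM horner_line_mx hornerE2.
  by under [RHS]eq_bigr => c _ do rewrite hornerM horner_line_mx hornerE2.
move/(congr1 (fun p : {poly C} => p`_1)); rewrite !coef_sum.
have id0 (x y : 'I_n) : (line_mx 1%:M Y x y)`_0 = (x == y)%:R.
  by rewrite coef0_line_mx value1 mxE.
have coef1L c : (line_mx 1%:M Y a c *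
    ((S X c b)%:P + 'X * (S (X *m Y) c b)%:P))`_1 =
    dvalue Y a c * S X c b + (a == c)%:R * S (X *m Y) c b.
  by rewrite mulrDr coefD coefMC mulrCA coefXM coefMC id0 coef1_line_mx.
have coef1R c : (((S X a c)%:P + 'X * (S (Y *m X) a c)%:P) *
    line_mx 1%:M Y c b)`_1 =
    S X a c * dvalue Y c b + S (Y *m X) a c * (c == b)%:R.
  by rewrite mulrDl coefD coefCM -mulrA coefXM coefCM id0 coef1_line_mx.
rewrite (eq_bigr _ (fun c _ => coef1L c)) (eq_bigr _ (fun c _ => coef1R c)).
rewrite !big_split /= [X in _ + X = _](bigD1 a) //=.
rewrite [X in _ + (_ + X) = _]big1; last first.
  by move=> c ca; rewrite eq_sym (negPf ca) mul0r.
rewrite [X in _ = _ + X](bigD1 b) //= [X in _ = _ + (_ + X)]big1.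
  by rewrite !eqxx mul1r mulr1 !addr0.
by move=> c cb; rewrite (negPf cb) mulr0.
Qed.

(** On matrix units this is [\sum_l e i l *m S (delta_mx l j)]
    (see [casimir_step_delta]), that is, multiplication by the matrix of
    operators [e i j].  Starting from [dvalue] and evaluating at the identity
    matrix it gives the Casimir elements of degree two and three. *)
Definition casimir_step (S : 'M[C]_r -> 'M[C]_n) X : 'M[C]_n :=
  \sum_i \sum_j dvalue (X *m delta_mx i j) *m S (delta_mx j i).

Lemma casimir_step_is_linear S : linear (casimir_step S).
Proof.
move=> c X Y; rewrite /casimir_step scaler_sumr -big_split /=.
apply: eq_bigr => i _; rewrite scaler_sumr -big_split /=.
apply: eq_bigr => j _.
by rewrite mulmxDl -scalemxAl linearP mulmxDl -scalemxAl.
Qed.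

HB.instance Definition _ S := GRing.isLinear.Build C 'M[C]_r 'M[C]_n _
  (casimir_step S) (casimir_step_is_linear S).

Lemma mul_mx_delta m X (j : 'I_r) (k : 'I_m) :
  X *m delta_mx j k = \sum_l X l j *: (delta_mx l k : 'M[C]_(r, m)).
Proof.
rewrite [X in LHS]matrix_sum_delta mulmx_suml; apply: eq_bigr => l _.
rewrite mulmx_suml (bigD1 j) //= -scalemxAl mul_delta_mx big1 ?addr0 //.
by move=> i ij; rewrite -scalemxAl mul_delta_mx_0 ?scaler0.
Qed.

Lemma mul_delta_mxr m (i : 'I_m) (j : 'I_r) X :
  delta_mx i j *m X = \sum_l X j l *: (delta_mx i l : 'M[C]_(m, r)).
Proof.
rewrite [X in LHS]matrix_sum_delta mulmx_sumr (bigD1 j) //= [X in _ + X]big1.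
  rewrite addr0 mulmx_sumr; apply: eq_bigr => l _.
  by rewrite -scalemxAr mul_delta_mx.
move=> k kj; rewrite mulmx_sumr big1 // => l _.
by rewrite -scalemxAr mul_delta_mx_0 ?scaler0 // eq_sym.
Qed.

(** The tensor [\sum_(i, j) delta_mx i j (x) delta_mx j i] intertwines
    multiplication by [X] on its two factors; together with the next lemma this
    makes it invariant under conjugation. *)
Lemma casimir_move_left (f h : {linear 'M[C]_r -> 'M[C]_n}) X :
  \sum_i \sum_j f (X *m delta_mx i j) *m h (delta_mx j i) =
  \sum_i \sum_j f (delta_mx i j) *m h (delta_mx j i *m X).
Proof.
under eq_bigr => i _ do under eq_bigr => j _ do
  rewrite mul_mx_delta linear_sum mulmx_suml.
under [RHS]eq_bigr => i _ do under eq_bigr => j _ do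
  rewrite mul_delta_mxr linear_sum mulmx_sumr.
rewrite (eq_bigr _ (fun i _ => exchange_big _ _ _ _ _ _)) exchange_big /=.
apply: eq_bigr => k _; rewrite exchange_big /=; apply: eq_bigr => j _.
by apply: eq_bigr => i _; rewrite linearZ -scalemxAl linearZ -scalemxAr.
Qed.

Lemma casimir_move_right (f h : {linear 'M[C]_r -> 'M[C]_n}) X :
  \sum_i \sum_j f (delta_mx i j *m X) *m h (delta_mx j i) =
  \sum_i \sum_j f (delta_mx i j) *m h (X *m delta_mx j i).
Proof.
under eq_bigr => i _ do under eq_bigr => j _ do
  rewrite mul_delta_mxr linear_sum mulmx_suml.
under [RHS]eq_bigr => i _ do under eq_bigr => j _ do
  rewrite mul_mx_delta linear_sum mulmx_sumr.
apply: eq_bigr => i _; rewrite exchange_big /=; apply: eq_bigr => k _.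
by apply: eq_bigr => j _; rewrite linearZ -scalemxAl linearZ -scalemxAr.
Qed.

Lemma casimir_step_equivariant (S : {linear 'M[C]_r -> 'M[C]_n}) :
  equivariant S -> equivariant (casimir_step S).
Proof.
move=> eqS g X gU; pose h := invmx g.
have hg Y : Y *m h *m g = Y by rewrite mulmxKV.
transitivity (\sum_i \sum_j dvalue (g *m X *m (g *m delta_mx i j) *m h)
    *m S (g *m delta_mx j i *m h) *m value g).
  rewrite /casimir_step mulmx_sumr; apply: eq_bigr => i _; rewrite mulmx_sumr.
  apply: eq_bigr => j _; rewrite -[X *m g *m _]hg mulmxA.
  rewrite (dvalue_equivariant _ gU) -mulmxA -[delta_mx j i in LHS]hg (eqS _ _ gU).
  by rewrite !mulmxA.
under eq_bigr => i _ do rewrite -mulmx_suml.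
rewrite -mulmx_suml; congr (_ *m _).
pose f1 : {linear 'M[C]_r -> 'M[C]_n} := dvalue \o mulmxr h \o mulmx (g *m X).
pose h1 : {linear 'M[C]_r -> 'M[C]_n} := S \o mulmxr h \o mulmx g.
rewrite -[LHS]/(\sum_i \sum_j f1 (g *m delta_mx i j) *m h1 (delta_mx j i)).
rewrite casimir_move_left /=.
pose f2 : {linear 'M[C]_r -> 'M[C]_n} := dvalue \o mulmx (g *m X).
pose h2 : {linear 'M[C]_r -> 'M[C]_n} := S \o mulmx g.
transitivity (\sum_i \sum_j f2 (delta_mx i j *m h) *m h2 (delta_mx j i)).
  apply: eq_bigr => i _; apply: eq_bigr => j _ /=.
  by rewrite !mulmxA mulmxK.
rewrite casimir_move_right; apply: eq_bigr => i _; apply: eq_bigr => j _ /=.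
by rewrite !mulmxA mulmxV // mul1mx.
Qed.

Lemma casimir_step_delta S i j :
  casimir_step S (delta_mx i j) =
  \sum_l dvalue (delta_mx i l) *m S (delta_mx l j).
Proof.
rewrite /casimir_step (bigD1 j) //= [X in _ + X]big1 ?addr0.
  by apply: eq_bigr => l _; rewrite mul_delta_mx.
move=> k kj; rewrite big1 // => l _.
by rewrite mul_delta_mx_0 ?linear0 ?mul0mx // eq_sym.
Qed.

(** This is equivariance at [X = invmx g]. *)
Lemma equivariant_central (S : 'M[C]_r -> 'M[C]_n) g : equivariant S ->
  g \in unitmx -> value g *m S 1%:M = S 1%:M *m value g.
Proof. by move=> eqS gU; have := eqS g (invmx g) gU; rewrite mulVmx ?mulmxV. Qed.

Section HighestWeight.
Variables (v : 'cV[C]_n) (a : 'I_r -> C).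
Hypothesis raise_v : forall i j : 'I_r, (i < j)%N ->
  dvalue (delta_mx i j) *m v = 0.
Hypothesis torus_v : forall i, dvalue (delta_mx i i) *m v = a i *: v.

(** [S] behaves on [v] like the differential does on a highest weight vector:
    the strictly upper triangular matrix units kill [v], the diagonal ones have
    it as an eigenvector. *)
Definition acts_by (S : 'M[C]_r -> 'M[C]_n) (s : 'I_r -> C) :=
  (forall i j : 'I_r, (i < j)%N -> S (delta_mx i j) *m v = 0) /\
  (forall i, S (delta_mx i i) *m v = s i *: v).

(** In [\sum_l e i l *m S (delta_mx l i)] the terms with [l < i] kill [v] at
    once.  In those with [l > i] the operator [e i l] is moved to the right,
    where it kills [v]; what remains is the commutator
    [S (delta_mx i i) - S (delta_mx l l)]. *)
Lemma acts_by_casimir_step (S : {linear 'M[C]_r -> 'M[C]_n}) s :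
  equivariant S -> acts_by S s ->
  acts_by (casimir_step S)
    (fun i => a i * s i + \sum_(l < r | (i < l)%N) (s i - s l)).
Proof.
move=> eqS [S0 Ss]; split=> [i j ij|i].
  rewrite casimir_step_delta mulmx_suml big1 // => l _; rewrite -mulmxA.
  have [lj|jl] := ltnP l j; first by rewrite S0 ?mulmx0.
  rewrite mulmxA (equivariant_bracket _ _ eqS) mulmxBl mulmxDl -mulmxA.
  have ne : (j == i) = false by apply/negbTE; rewrite neq_ltn ij orbT.
  rewrite mul_delta_mx mul_delta_mx_0 ?ne // linear0 mul0mx subr0.
  by rewrite raise_v ?mulmx0 ?S0 ?addr0 //; apply: leq_trans ij jl.
rewrite casimir_step_delta mulmx_suml (bigD1 i) //= -mulmxA Ss -scalemxAr.
rewrite torus_v scalerA scalerDl [s i * _]mulrC; congr (_ + _).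
rewrite (bigID (fun l : 'I_r => (i < l)%N)) /= [X in _ + X]big1 ?addr0.
  rewrite scaler_suml; apply: eq_big => [l|l /andP[_ il]].
    by rewrite andb_idl // => il; rewrite neq_ltn il orbT.
  rewrite (equivariant_bracket _ _ eqS) mulmxBl mulmxDl -mulmxA raise_v //.
  by rewrite mulmx0 add0r !mul_delta_mx !Ss scalerBl.
move=> l /andP[li il]; rewrite -mulmxA S0 ?mulmx0 // ltn_neqAle.
by rewrite leqNgt il andbT.
Qed.

Lemma acts_by_central (S : {linear 'M[C]_r -> 'M[C]_n}) s : acts_by S s ->
  S 1%:M *m v = (\sum_i s i) *: v.
Proof.
case=> _ Ss; rewrite [1%:M]matrix_sum_delta linear_sum mulmx_suml scaler_suml.
apply: eq_bigr => i _; rewrite linear_sum mulmx_suml (bigD1 i) //= mxE eqxx.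
rewrite scale1r Ss big1 ?addr0 // => j ji.
by rewrite mxE eq_sym (negPf ji) scale0r linear0 mul0mx.
Qed.

End HighestWeight.

End MatrixRep.

(** * Weight projections *)

Section Torus.
Variables (C : numFieldType) (r n : nat) (Q : 'M[{mpoly C[r * r]}]_n).
Hypothesis value1 : value Q 1%:M = 1%:M.
Hypothesis valueM : forall g h, g \in unitmx -> h \in unitmx ->
  value Q (g *m h) = value Q g *m value Q h.
Implicit Types (s : 'I_r -> C) (m : 'X_{1..r}).

Definition torus_elt (t : 'I_r -> C) : 'M[C]_r := diag_mx (\row_i t i).

(** The entries of the representation as polynomials on the diagonal torus. *)
Definition torus_value : 'M[{mpoly C[r]}]_n := map_mx
  (comp_mpoly [tuple mxvec (diag_mx (\row_i 'X_i)) 0 k | k < r * r]) Q.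

(** The coefficient of the character [m] of the torus; it will turn out to be
    the projection onto the weight space of weight [m]. *)
Definition weight_proj m : 'M[C]_n := map_mx (mcoeff m) torus_value.

(** Only finitely many characters occur, all of degree less than this bound. *)
Definition weight_bound := (\max_a \max_b msize (torus_value a b))%N.

Lemma meval_torus_value (t : 'I_r -> C) a b :
  (torus_value a b).@[t] = value Q (torus_elt t) a b.
Proof.
rewrite !mxE comp_mpoly_meval; apply: meval_eq => k; rewrite tnth_mktuple.
case/mxvec_indexP: k => i j; rewrite !mxvecE !mxE.
by case: eqP => _; rewrite ?mulr1n ?mulr0n ?meval0 ?mevalXU.
Qed.

Lemma torus_elt_unit (t : 'I_r -> C) :
  (forall i, t i != 0) -> torus_elt t \in unitmx.
Proof.
move=> t0; rewrite unitmxE det_diag unitfE; apply/prodf_neq0 => i _.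
by rewrite mxE.
Qed.

Lemma msize_torus_value a b : (msize (torus_value a b) <= weight_bound)%N.
Proof. by apply: leq_trans (leq_bigmax a); apply: (leq_bigmax b). Qed.

Lemma torus_elt_expand (t : 'I_r -> C) : value Q (torus_elt t) =
  \sum_(m : 'X_{1..r < weight_bound}) (\prod_i t i ^+ m i) *: weight_proj m.
Proof.
apply/matrixP => a b; rewrite -meval_torus_value summxE.
rewrite {1}(mpolywE (msize_torus_value a b)) rmorph_sum /=.
by apply: eq_bigr => m _; rewrite mevalZ mevalX !mxE mulrC.
Qed.

Lemma weight_proj_out m : (weight_bound <= mdeg m)%N -> weight_proj m = 0.
Proof.
move=> Bm; apply/matrixP => a b; rewrite [RHS]mxE mxE.
apply/memN_msupp_eq0; apply: contraL Bm => /msize_mdeg_lt mB; rewrite -ltnNge.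
exact: leq_trans mB (msize_torus_value a b).
Qed.

Lemma weight_projE (v : 'cV[C]_n) m :
  (forall t : 'I_r -> C, (forall i, t i != 0) ->
     value Q (torus_elt t) *m v = (\prod_i t i ^+ m i) *: v) ->
  weight_proj m *m v = v.
Proof.
move=> vm; apply/matrixP => a b; rewrite mxE.
have /(congr1 (mcoeff m)) : \sum_c v c b *: torus_value a c = v a b *: 'X_[m].
  apply: mpoly_eq_on_torus => t t0.
  have /matrixP/(_ a b) := vm t t0; rewrite !mxE mevalZ mevalX mulrC => <-.
  rewrite rmorph_sum /=; apply: eq_bigr => c _.
  by rewrite mevalZ meval_torus_value mulrC.
rewrite mcoeffZ mcoeffX eqxx mulr1 => <-; rewrite linear_sum /=.
by apply: eq_bigr => c _; rewrite [weight_proj m a c]mxE mcoeffZ mulrC.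
Qed.

Lemma mcoeff_reweight (p : {mpoly C[r]}) (c : 'X_{1..r} -> C) m :
  (\sum_(k <- msupp p) (p@_k * c k) *: 'X_[k])@_m = p@_m * c m.
Proof.
rewrite linear_sum /=; have [mp|mp] := boolP (m \in msupp p).
  rewrite (bigD1_seq m) //= mcoeffZ mcoeffX eqxx mulr1 big1 ?addr0 // => k km.
  by rewrite mcoeffZ mcoeffX (negPf km) mulr0.
rewrite (memN_msupp_eq0 mp) mul0r big_seq big1 // => k kp.
rewrite mcoeffZ mcoeffX; case: eqP => [km|]; last by rewrite mulr0.
by rewrite -km kp in mp.
Qed.

(** Compare the coefficients of the character [m] of [t] in
    [value (t * s) = value t *m value s], for fixed [s]. *)
Lemma weight_proj_torus s m : (forall i, s i != 0) ->
  weight_proj m *m value Q (torus_elt s) = (\prod_i s i ^+ m i) *: weight_proj m.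
Proof.
move=> s0; apply/matrixP => a b; rewrite !mxE.
pose c k := \prod_i s i ^+ k i : C.
have /(congr1 (mcoeff m)) :
    \sum_c value Q (torus_elt s) c b *: torus_value a c =
    \sum_(k <- msupp (torus_value a b)) ((torus_value a b)@_k * c k) *: 'X_[k].
  apply: mpoly_eq_on_torus => t t0; rewrite !rmorph_sum /=.
  transitivity (value Q (torus_elt (fun i => t i * s i)) a b).
    have -> : torus_elt (fun i => t i * s i) = torus_elt t *m torus_elt s.
      by rewrite mulmx_diag; congr diag_mx; apply/rowP => i; rewrite !mxE.
    rewrite valueM ?torus_elt_unit // mxE; apply: eq_bigr => d _.
    by rewrite mevalZ meval_torus_value mulrC.
  rewrite -meval_torus_value mevalE; apply: eq_bigr => k _.
  rewrite mevalZ mevalX -mulrA [c k * _]mulrC -big_split; congr (_ * _).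
  by apply: eq_bigr => i _; rewrite exprMn.
rewrite mcoeff_reweight mulrC !mxE => <-; rewrite linear_sum /=.
by apply: eq_bigr => d _; rewrite [weight_proj m a d]mxE mcoeffZ mulrC.
Qed.

(** Compare the coefficients of the character [m'] in [weight_proj_torus]. *)
Lemma mul_weight_proj m m' :
  weight_proj m *m weight_proj m' = (m == m')%:R *: weight_proj m.
Proof.
apply/matrixP => a b; rewrite [LHS]mxE [RHS]mxE mulrC.
have /(congr1 (mcoeff m')) :
    \sum_c weight_proj m a c *: torus_value c b =
    weight_proj m a b *: 'X_[m].
  apply: mpoly_eq_on_torus => t t0; rewrite rmorph_sum /= mevalZ mevalX mulrC.
  have /matrixP/(_ a b) := weight_proj_torus m t0.
  rewrite [X in _ = X -> _]mxE => <-; rewrite mxE; apply: eq_bigr => c _.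
  by rewrite mevalZ meval_torus_value.
rewrite mcoeffZ mcoeffX => <-.
rewrite linear_sum /=; apply: eq_bigr => c _.
by rewrite [weight_proj m' c b]mxE mcoeffZ.
Qed.

Lemma torus_weight_proj s m : (forall i, s i != 0) ->
  value Q (torus_elt s) *m weight_proj m = (\prod_i s i ^+ m i) *: weight_proj m.
Proof.
move=> s0; rewrite torus_elt_expand mulmx_suml.
have [mB|mB] := ltnP (mdeg m) weight_bound; last first.
  by rewrite weight_proj_out // scaler0 big1 // => k _; rewrite mulmx0.
rewrite (bigD1 (BMultinom mB)) //= -scalemxAl mul_weight_proj eqxx scale1r.
rewrite [X in _ + X]big1 ?addr0 // => k km.
rewrite -scalemxAl mul_weight_proj.
rewrite bmeqP in km.
by rewrite (negPf km) scale0r scaler0.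
Qed.

Lemma sum_weight_proj :
  \sum_(m : 'X_{1..r < weight_bound}) weight_proj m = 1%:M.
Proof.
rewrite -value1; have -> : 1%:M = torus_elt (fun=> 1).
  apply/matrixP => i j; rewrite !mxE.
  by [].
rewrite torus_elt_expand; apply: eq_bigr => m _.
by rewrite big1 ?scale1r // => i _; rewrite expr1n.
Qed.

(** If [A = K *m R] is a full rank factorization, then [A *m A = A] forces
    [R *m K] to be the identity of size [\rank A], and [\tr A = \tr (R *m K)]. *)
Lemma mxtrace_idempotent (A : 'M[C]_n) : A *m A = A -> \tr A = (\rank A)%:R.
Proof.
move=> AA; rewrite -{1}(mulmx_base A) mxtrace_mulC.
suff -> : row_base A *m col_base A = 1%:M by rewrite mxtrace1.
move: (mulmx_base A) (row_base_free A) (col_base_full A).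
move: (row_base A) (col_base A) => R K KR Rfree Kfull.
apply: (row_free_inj Rfree); apply: (row_full_inj Kfull).
by rewrite mul1mx !mulmxA KR -mulmxA KR.
Qed.

Lemma mxtrace_weight_proj m : \tr (weight_proj m) = (\rank (weight_proj m))%:R.
Proof. by apply: mxtrace_idempotent; rewrite mul_weight_proj eqxx scale1r. Qed.

Lemma one_plus_delta i t : 1%:M + t *: delta_mx i i =
  torus_elt (fun j => 1 + (j == i)%:R * t).
Proof.
apply/matrixP => j k; rewrite !mxE; have [<-|jk] := eqVneq j k.
  by rewrite andbb mulr1n mulrC.
have [ji|_] := eqVneq j i; last by rewrite mulr0 addr0.
by rewrite eq_sym -ji (negPf jk) mulr0 addr0.
Qed.

Lemma prod_one_plus i m (t : C) :
  \prod_j (1 + (j == i)%:R * t) ^+ m j = (1 + t) ^+ m i.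
Proof.
rewrite (bigD1 i) //= eqxx mul1r big1 ?mulr1 // => j ji.
by rewrite (negPf ji) mul0r addr0 expr1n.
Qed.

(** The matrix [1 + t delta_mx i i] lies in the torus and acts on the weight
    space of [m] by [(1 + t) ^+ m i], whose linear coefficient is [m i]. *)
Lemma dvalue_torus i : dvalue Q (delta_mx i i) =
  \sum_(m : 'X_{1..r < weight_bound}) (m i)%:R *: weight_proj m.
Proof.
apply/matrixP => a b; rewrite -coef1_line_mx summxE.
have -> : line_mx Q 1%:M (delta_mx i i) a b =
    \sum_(m : 'X_{1..r < weight_bound}) (weight_proj m a b) *: (1 + 'X) ^+ m i.
  apply: (@poly_eq_off_roots _ 1); rewrite ?oner_eq0 // => t _.
  rewrite horner_line_mx one_plus_delta torus_elt_expand summxE horner_sum.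
  apply: eq_bigr => m _.
  by rewrite hornerZ horner_exp hornerD hornerX hornerC mxE mulrC prod_one_plus.
rewrite coef_sum; apply: eq_bigr => m _.
by rewrite coefZ [RHS]mxE mulrC coef1_expr1DX.
Qed.

Lemma mul_weight_sums (f g : 'X_{1..r} -> C) :
  (\sum_(m : 'X_{1..r < weight_bound}) f m *: weight_proj m) *m
  (\sum_(m : 'X_{1..r < weight_bound}) g m *: weight_proj m) =
  \sum_(m : 'X_{1..r < weight_bound}) (f m * g m) *: weight_proj m.
Proof.
rewrite mulmx_suml; apply: eq_bigr => m _.
rewrite mulmx_sumr (bigD1 m) //= big1 ?addr0 => [|k km]; last first.
  rewrite -scalemxAl -scalemxAr mul_weight_proj eq_sym -bmeqP (negPf km).
  by rewrite scale0r !scaler0.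
by rewrite -scalemxAl -scalemxAr mul_weight_proj eqxx scale1r scalerA.
Qed.

(** First-order part of a one-parameter family acting on [v] by scalars. *)
Lemma dvalue_eigen (v : 'cV[C]_n) X (d f : {poly C}) : d != 0 ->
  (forall t, d.[t] != 0 -> value Q (1%:M + t *: X) *m v = f.[t] *: v) ->
  dvalue Q X *m v = f`_1 *: v.
Proof.
move=> d0 vf; apply/matrixP => a b; rewrite !mxE.
have /(congr1 (fun p : {poly C} => p`_1)) :
    \sum_c v c b *: line_mx Q 1%:M X a c = v a b *: f.
  apply: (poly_eq_off_roots d0) => t /vf /matrixP/(_ a b).
  rewrite !mxE hornerZ mulrC => <-; rewrite horner_sum; apply: eq_bigr => c _.
  by rewrite hornerZ horner_line_mx mulrC.
rewrite coefZ mulrC => <-; rewrite coef_sum; apply: eq_bigr => c _.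
by rewrite coefZ coef1_line_mx mulrC.
Qed.

End Torus.

(** * Traces of products of matrix units *)

Section TraceRelations.
Variables (C : numFieldType) (r n : nat) (Q : 'M[{mpoly C[r * r]}]_n).
Hypothesis value1 : value Q 1%:M = 1%:M.
Hypothesis valueM : forall g h, g \in unitmx -> h \in unitmx ->
  value Q (g *m h) = value Q g *m value Q h.

Let e (i j : 'I_r) : 'M[C]_n := dvalue Q (delta_mx i j).
Let M1 i := \tr (e i i).
Let M2 i j := \tr (e i i *m e j j).
Let M3 i j k := \tr (e i i *m e j j *m e k k).

Lemma dvalue_commute i j k l : e i j *m e k l =
  e k l *m e i j + (j == k)%:R *: e i l - (l == i)%:R *: e k j.
Proof.
have mulE (a b c d : 'I_r) : dvalue Q (delta_mx a b *m delta_mx c d) =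
    (b == c)%:R *: e a d :> 'M[C]_n.
  have [->|bc] := eqVneq b c; first by rewrite mul_delta_mx scale1r.
  by rewrite mul_delta_mx_0 // linear0 scale0r.
rewrite /e (equivariant_bracket value1) /= ?mulE //.
exact: (dvalue_equivariant valueM).
Qed.

Lemma mxtraceN (A : 'M[C]_n) : \tr (- A) = - \tr A.
Proof. exact: linearN. Qed.

Lemma mxtraceB (A B : 'M[C]_n) : \tr (A - B) = \tr A - \tr B.
Proof. exact: linearB. Qed.

(** Invariance of the trace form: [\tr (H [x, y]) = \tr ([H, x] y)]. *)
Lemma mxtrace_commutators (H x y K L : 'M[C]_n) :
  H *m x = x *m H + K -> x *m y = y *m x + L -> \tr (H *m L) = \tr (K *m y).
Proof.
move=> Hx xy; have -> : L = x *m y - y *m x by rewrite xy addrC addKr.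
have -> : K = H *m x - x *m H by rewrite Hx addrC addKr.
rewrite mulmxBr mulmxBl !mxtraceB !mulmxA; congr (_ - _).
by rewrite mxtrace_mulC mulmxA.
Qed.

(** Take [H = e i i], [x = e i j], [y = e j i] in [mxtrace_commutators]; then
    [[H, x] = x] and [[x, y] = e i i - e j j]. *)
Lemma mxtrace_root_pair i j : i != j -> \tr (e i j *m e j i) = M2 i i - M2 i j.
Proof.
move=> ij; rewrite -(@mxtrace_commutators (e i i) (e i j) _ _ (e i i - e j j)).
- by rewrite mulmxBr mxtraceB.
- by rewrite dvalue_commute eqxx eq_sym (negPf ij) scale1r scale0r subr0.
- by rewrite dvalue_commute !eqxx !scale1r addrA.
Qed.

(** As for [mxtrace_root_pair], with [H = e i i *m e i i]; now
    [[H, x] = 2 e i i x - x]. *)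
Lemma mxtrace_diag_root_pair i j : i != j -> \tr (e i i *m e i j *m e j i) *+ 2 =
  M3 i i i - M3 i i j + M2 i i - M2 i j.
Proof.
move=> ij; have Hx : e i i *m e i j = e i j *m e i i + e i j.
  by rewrite dvalue_commute eqxx eq_sym (negPf ij) scale1r scale0r subr0.
have HHx : e i i *m e i i *m e i j = e i j *m (e i i *m e i i) +
    ((e i i *m e i j) *+ 2 - e i j).
  rewrite -mulmxA Hx mulmxDr mulmxA Hx mulmxDl -mulmxA -addrA; congr (_ + _).
  by rewrite mulr2n [in RHS]addrA addrK addrC.
have := mxtrace_commutators HHx (L := e i i - e j j) (y := e j i).
rewrite mulmxBr mulmxBl mulr2n mulmxDl !mxtraceB -/(M3 _ _ _) -/(M3 _ _ _).
rewrite mxtraceD mxtrace_root_pair // => -> //; last first.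
  by rewrite dvalue_commute !eqxx !scale1r addrA.
by rewrite -addrA subrK.
Qed.

(** Take [H = e i i *m e j j], [x = e j k], [y = e k j] in
    [mxtrace_commutators]; then [[H, x] = e i i x]. *)
Lemma mxtrace_diag_disjoint_pair i j k : i != j -> j != k -> i != k ->
  \tr (e i i *m e j k *m e k j) = M3 i j j - M3 i j k.
Proof.
move=> ij jk ik.
rewrite -(@mxtrace_commutators (e i i *m e j j) (e j k) _ _ (e j j - e k k)).
- by rewrite mulmxBr mxtraceB.
- rewrite -mulmxA dvalue_commute eqxx [k == j]eq_sym (negPf jk) scale1r scale0r.
  rewrite subr0 mulmxDr mulmxA dvalue_commute (negPf ij) [k == i]eq_sym.
  by rewrite (negPf ik) !scale0r addr0 subr0 mulmxA.
- by rewrite dvalue_commute !eqxx !scale1r addrA.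
Qed.

(** The trace of the commutator of [A] with [X *m Y *m Z] vanishes, and
    commutation with [A] is a derivation. *)
Lemma mxtrace_derivation (A X Y Z X' Y' Z' : 'M[C]_n) :
  A *m X = X *m A + X' -> A *m Y = Y *m A + Y' -> A *m Z = Z *m A + Z' ->
  \tr (X' *m Y *m Z) + \tr (X *m Y' *m Z) + \tr (X *m Y *m Z') = 0.
Proof.
move=> AX AY AZ; have := mxtrace_mulC A (X *m Y *m Z).
rewrite !mulmxA AX !mulmxDl -[X *m A *m Y]mulmxA AY mulmxDr mulmxDl !mulmxA.
rewrite -[X *m Y *m A *m Z]mulmxA AZ mulmxDr !mulmxA !mxtraceD.
by move/eqP; rewrite -subr_eq0 => /eqP eq0; rewrite -[RHS]eq0; ring.
Qed.

(** Apply [mxtrace_derivation] with [A = e i j] to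
    [e i i *m e j k *m e k i]. *)
Lemma mxtrace_three_cycle i j k : i != j -> j != k -> i != k ->
  \tr (e i j *m e j k *m e k i) =
  \tr (e i i *m e i k *m e k i) - \tr (e i i *m e j k *m e k j).
Proof.
move=> ij jk ik.
have := @mxtrace_derivation (e i j) (e i i) (e j k) (e k i)
  (- e i j) (e i k) (- e k j).
rewrite !mulNmx mulmxN !mxtraceN => H; apply/eqP.
rewrite eq_sym -subr_eq0; apply/eqP; rewrite -[RHS]H; first by ring.
- by rewrite dvalue_commute eqxx eq_sym (negPf ij) scale0r scale1r addr0.
- by rewrite dvalue_commute eqxx [k == i]eq_sym (negPf ik) scale0r scale1r subr0.
- by rewrite dvalue_commute eqxx (negPf jk) scale0r scale1r addr0.
Qed.

Lemma casimir_step_1 S : casimir_step Q S 1%:M =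
  \sum_i \sum_l e i l *m S (delta_mx l i).
Proof.
by apply: eq_bigr => i _; apply: eq_bigr => l _; rewrite mul1mx.
Qed.

Lemma mxtrace_casimir2 : \tr (casimir_step Q (dvalue Q) 1%:M) =
  \sum_i \sum_j \tr (e i j *m e j i).
Proof.
rewrite casimir_step_1 linear_sum; apply: eq_bigr => i _.
by rewrite linear_sum.
Qed.

Lemma mxtrace_casimir3 :
  \tr (casimir_step Q (casimir_step Q (dvalue Q)) 1%:M) =
  \sum_i \sum_j \sum_k \tr (e i j *m e j k *m e k i).
Proof.
rewrite casimir_step_1 linear_sum; apply: eq_bigr => i _.
rewrite linear_sum; apply: eq_bigr => j _ /=.
rewrite casimir_step_delta mulmx_sumr linear_sum; apply: eq_bigr => k _ /=.
by rewrite mulmxA.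
Qed.

(** Equivariance under permutation matrices; it makes the traces below depend
    only on the pattern of equalities between their indices. *)
Lemma value_perm_conj (s : 'S_r) i :
  e (s i) (s i) = value Q (perm_mx s^-1) *m e i i *m value Q (perm_mx s).
Proof.
have ps (u : 'S_r) : (perm_mx u : 'M[C]_r) \in unitmx by apply: unitmx_perm.
have := dvalue_equivariant valueM (delta_mx (s i) i) (ps s).
have -> : delta_mx (s i) i *m perm_mx s = delta_mx (s i) (s i) :> 'M[C]_r.
  rewrite mul_delta_mxr (bigD1 (s i)) //= big1 ?addr0 => [|j ji].
    by rewrite !mxE eqxx scale1r.
  by rewrite !mxE eq_sym (negPf ji) scale0r.
have -> : perm_mx s *m delta_mx (s i) i = delta_mx i i :> 'M[C]_r.
  rewrite mul_mx_delta (bigD1 i) //= big1 ?addr0 => [|j ji].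
    by rewrite !mxE eqxx scale1r.
  by rewrite !mxE (inj_eq perm_inj) (negPf ji) scale0r.
move=> conj; rewrite -mulmxA /e -conj mulmxA -valueM //.
by rewrite -perm_mxM mulVg perm_mx1 value1 mul1mx.
Qed.

Lemma value_perm_cancel (s : 'S_r) :
  value Q (perm_mx s) *m value Q (perm_mx s^-1) = 1%:M.
Proof. by rewrite -valueM ?unitmx_perm // -perm_mxM mulgV perm_mx1 value1. Qed.

Lemma mxtrace_perm1 (s : 'S_r) i : M1 (s i) = M1 i.
Proof.
by rewrite /M1 value_perm_conj mxtrace_mulC mulmxA value_perm_cancel mul1mx.
Qed.

Lemma mxtrace_perm2 (s : 'S_r) i j : M2 (s i) (s j) = M2 i j.
Proof.
rewrite /M2 !value_perm_conj mulmxA mxtrace_mulC !mulmxA value_perm_cancel.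
by rewrite mul1mx -[_ *m value Q (perm_mx s) *m _]mulmxA value_perm_cancel mulmx1.
Qed.

Lemma mxtrace_perm3 (s : 'S_r) i j k : M3 (s i) (s j) (s k) = M3 i j k.
Proof.
rewrite /M3 !value_perm_conj mulmxA mxtrace_mulC !mulmxA value_perm_cancel.
rewrite mul1mx -[_ *m value Q (perm_mx s) *m _]mulmxA value_perm_cancel mulmx1.
by rewrite -[_ *m value Q (perm_mx s) *m _]mulmxA value_perm_cancel mulmx1.
Qed.

End TraceRelations.

(** * Symmetric tensors and power sums *)

Section Patterns.
Variable r : nat.

Lemma exists_perm2 (i0 i1 i j : 'I_r) : i0 != i1 -> i != j ->
  exists s : 'S_r, s i = i0 /\ s j = i1.
Proof.
move=> i01 ij; pose s := tperm i i0.
have sj : s j != i0 by rewrite -[i0](tpermL i i0) (inj_eq perm_inj) eq_sym.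
have si : s i = i0 by rewrite tpermL.
exists (s * tperm (s j) i1)%g; rewrite !permM si; split; last exact: tpermL.
by rewrite tpermD // eq_sym.
Qed.

Lemma exists_perm3 (i0 i1 i2 i j k : 'I_r) :
  i0 != i1 -> i0 != i2 -> i1 != i2 -> i != j -> i != k -> j != k ->
  exists s : 'S_r, [/\ s i = i0, s j = i1 & s k = i2].
Proof.
move=> i01 i02 i12 ij ik jk.
have [s [si sj]] := exists_perm2 i01 ij.
have sk0 : s k != i0 by rewrite -si (inj_eq perm_inj) eq_sym.
have sk1 : s k != i1 by rewrite -sj (inj_eq perm_inj) eq_sym.
exists (s * tperm (s k) i2)%g; rewrite !permM tpermL si sj.
by split=> //; rewrite tpermD // eq_sym.
Qed.

Variable F : fieldType.

Lemma perm_invariant1 (f : 'I_r -> F) :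
  (forall (s : 'S_r) i, f (s i) = f i) -> exists c, forall i, f i = c.
Proof.
move=> fs; case: (posnP r) => [r0|r0].
  by exists 0 => i; have := leq_trans (ltn_ord i) (eq_leq r0).
exists (f (Ordinal r0)) => i.
by rewrite -(fs (tperm i (Ordinal r0)) i) tpermL.
Qed.

Lemma perm_invariant2 (f : 'I_r -> 'I_r -> F) : (1 < r)%N ->
  (forall (s : 'S_r) i j, f (s i) (s j) = f i j) ->
  exists b d, forall i j, f i j = b + d * (i == j)%:R.
Proof.
move=> r1 fs; pose i0 := Ordinal (ltnW r1); pose i1 := Ordinal r1.
exists (f i0 i1), (f i0 i0 - f i0 i1) => i j.
have [<-|ij] := eqVneq i j.
  by rewrite mulr1 addrC subrK -(fs (tperm i i0) i) tpermL.
by have [s [<- <-]] := @exists_perm2 i0 i1 i j isT ij; rewrite mulr0 addr0 fs.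
Qed.

(** A tensor symmetric under relabelling takes only three values, [p] on equal
    indices, [q] when exactly two coincide and [s] on distinct ones; [a], [b],
    [c] are the coefficients of the resulting combination of Kronecker deltas. *)
Lemma perm_invariant3 (f : 'I_r -> 'I_r -> 'I_r -> F) : (2 < r)%N ->
  (forall (s : 'S_r) i j k, f (s i) (s j) (s k) = f i j k) ->
  (forall i j k, f i j k = f j i k) -> (forall i j k, f i j k = f i k j) ->
  exists a b c, forall i j k, f i j k =
    a + b * ((i == j)%:R + (j == k)%:R + (i == k)%:R)
      + c * ((i == j)%:R * (j == k)%:R).
Proof.
move=> r2 fs f12 f23.
pose i0 := Ordinal (ltnW (ltnW r2)); pose i1 := Ordinal (ltnW r2).
pose i2 := Ordinal r2; pose p := f i0 i0 i0; pose q := f i0 i0 i1.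
pose s := f i0 i1 i2; exists s, (q - s), (p - 3%:R * q + 2%:R * s) => i j k.
have fiij x y : x != y -> f x x y = q.
  by move=> xy; have [u [ux uy]] := @exists_perm2 i0 i1 x y isT xy;
    rewrite -(fs u) ux uy.
have [<-|ij] := eqVneq i j.
  have [<-|ik] := eqVneq i k; last by rewrite fiij //; rewrite /=; ring.
  by rewrite -(fs (tperm i i0)) tpermL -/p; rewrite /=; ring.
have [<-|jk] := eqVneq j k.
  by rewrite (negPf ij) f12 f23 fiij 1?eq_sym //; rewrite /=; ring.
have [<-|ik] := eqVneq i k; first by rewrite f23 fiij //; rewrite /=; ring.
have [u [ui uj uk]] := @exists_perm3 i0 i1 i2 i j k isT isT isT ij ik jk.
by rewrite -(fs u) ui uj uk -/s; rewrite /=; ring.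
Qed.

End Patterns.

Section SymmetricSums.
Variables (R : comNzRingType) (r : nat) (x : 'I_r -> R).
Implicit Types a b c : R.

Lemma sum_delta i (f : 'I_r -> R) : \sum_j (i == j)%:R * f j = f i.
Proof.
rewrite (bigD1 i) //= eqxx mul1r big1 ?addr0 // => j ji.
by rewrite eq_sym (negPf ji) mul0r.
Qed.

Lemma sum_pattern2 b d :
  \sum_i \sum_j (b + d * (i == j)%:R) * (x i * x j) =
  b * (\sum_i x i) ^+ 2 + d * (\sum_i x i ^+ 2).
Proof.
rewrite expr2 mulr_suml !mulr_sumr -big_split /=; apply: eq_bigr => i _.
rewrite !mulr_sumr -[X in _ + d * X](sum_delta i (fun j => x i * x j)).
rewrite mulr_sumr -big_split /=; apply: eq_bigr => j _; ring.
Qed.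

Lemma sum_pattern3 a b c :
  \sum_i \sum_j \sum_k (a + b * ((i == j)%:R + (j == k)%:R + (i == k)%:R)
      + c * ((i == j)%:R * (j == k)%:R)) * (x i * x j * x k) =
  a * (\sum_i x i) ^+ 3 + 3%:R * b * (\sum_i x i) * (\sum_i x i ^+ 2)
  + c * (\sum_i x i ^+ 3).
Proof.
set e := \sum_i x i; set p2 := \sum_i x i ^+ 2.
have inner i j : \sum_k (a + b * ((i == j)%:R + (j == k)%:R + (i == k)%:R)
      + c * ((i == j)%:R * (j == k)%:R)) * (x i * x j * x k) =
    (a * e + b * x i + b * x j
      + (b * e + c * x i) * (i == j)%:R) * (x i * x j).
  transitivity (\sum_k ((a + b * (i == j)%:R) * (x i * x j) * x k
      + (b + c * (i == j)%:R) * (x i * x j) * ((j == k)%:R * x k)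
      + b * (x i * x j) * ((i == k)%:R * x k))).
    by apply: eq_bigr => k _; ring.
  rewrite !big_split /= -!mulr_sumr !sum_delta -/e.
  by have [<-|_] := eqVneq i j; rewrite /=; ring.
under eq_bigr => i _ do under eq_bigr => j _ do rewrite inner.
have outer i : \sum_j (a * e + b * x i + b * x j
      + (b * e + c * x i) * (i == j)%:R) * (x i * x j) =
    (a * e * e + b * p2) * x i + (2%:R * b * e) * x i ^+ 2 + c * x i ^+ 3.
  transitivity (\sum_j ((a * e + b * x i) * x i * x j + b * x i * x j ^+ 2
      + (b * e + c * x i) * x i * ((i == j)%:R * x j))).
    by apply: eq_bigr => j _; ring.
  by rewrite !big_split /= -!mulr_sumr !sum_delta -/e -/p2; ring.
rewrite (eq_bigr _ (fun i _ => outer i)) !big_split /= -!mulr_sumr -/e -/p2.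
ring.
Qed.

Lemma sum_lt_pairs (f : 'I_r -> 'I_r -> R) : (forall i j, f i j = f j i) ->
  2%:R * (\sum_(i < r) \sum_(j < r | (i < j)%N) f i j) =
  \sum_i \sum_j f i j - \sum_i f i i.
Proof.
move=> fC; rewrite mulr2n mulrDl !mul1r.
rewrite {2}(exchange_big_dep xpredT) //=; apply/eqP; rewrite eq_sym subr_eq.
apply/eqP; rewrite -!big_split /=; apply: eq_bigr => i _.
rewrite (bigD1 i) //= addrC; congr (_ + _).
rewrite (bigID (fun j : 'I_r => (i < j)%N)) /=; congr (_ + _).
  by apply: eq_bigl => j; rewrite andb_idl // => ij; rewrite neq_ltn ij orbT.
apply: eq_big => [j|j _]; last by rewrite fC.
by rewrite -leqNgt [RHS]ltn_neqAle.
Qed.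

(** Summed over the six orderings of a triple of indices, the indicator of a
    strictly increasing triple is
    [1 - (i == j) - (j == k) - (i == k) + 2 (i == j) (j == k)], to which
    [sum_pattern3] applies. *)
Lemma sum_lt_triples :
  6%:R * (\sum_(i < r) \sum_(j < r | (i < j)%N) \sum_(k < r | (j < k)%N)
    x i * x j * x k) =
  (\sum_i x i) ^+ 3 - 3%:R * (\sum_i x i) * (\sum_i x i ^+ 2)
  + 2%:R * (\sum_i x i ^+ 3).
Proof.
pose w (i j k : 'I_r) : R := ((i < j) && (j < k))%N%:R.
pose T (f : 'I_r -> 'I_r -> 'I_r -> R) :=
  \sum_i \sum_j \sum_k f i j k * (x i * x j * x k).
have T12 f : T f = T (fun i j k => f j i k).
  rewrite /T exchange_big; apply: eq_bigr => i _; apply: eq_bigr => j _.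
  by apply: eq_bigr => k _; rewrite [x j * x i]mulrC.
have T23 f : T f = T (fun i j k => f i k j).
  rewrite /T; apply: eq_bigr => i _; rewrite exchange_big.
  by apply: eq_bigr => j _; apply: eq_bigr => k _; rewrite mulrAC.
have -> : \sum_(i < r) \sum_(j < r | (i < j)%N) \sum_(k < r | (j < k)%N)
    x i * x j * x k = T w.
  apply: eq_bigr => i _; rewrite big_mkcond; apply: eq_bigr => j _.
  have [ij|ij] := boolP (i < j)%N; last first.
    by rewrite big1 // => k _; rewrite /w (negPf ij) mul0r.
  rewrite big_mkcond; apply: eq_bigr => k _; rewrite /w ij /=.
  by case: ifP; rewrite ?mul1r ?mul0r.
have TD f g : T f + T g = T (fun i j k => f i j k + g i j k).
  rewrite /T -big_split; apply: eq_bigr => i _; rewrite -big_split.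
  apply: eq_bigr => j _; rewrite -big_split; apply: eq_bigr => k _ /=.
  by rewrite mulrDl.
have -> : 6%:R * T w = T w + T (fun i j k => w i k j) + T (fun i j k => w j i k)
    + T (fun i j k => w j k i) + T (fun i j k => w k i j)
    + T (fun i j k => w k j i).
  have e1 : T (fun i j k => w i k j) = T w by rewrite -T23.
  have e2 : T (fun i j k => w j i k) = T w by rewrite -T12.
  have e3 : T (fun i j k => w j k i) = T w.
    by rewrite (T12 (fun i j k => w j k i)) e1.
  have e4 : T (fun i j k => w k i j) = T w.
    by rewrite (T23 (fun i j k => w k i j)) e2.
  have e5 : T (fun i j k => w k j i) = T w.
    by rewrite (T12 (fun i j k => w k j i)) e4.
  by rewrite e1 e2 e3 e4 e5; ring.
rewrite !TD.
have := sum_pattern3 1 (- 1) 2%:R; rewrite mul1r => pattern.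
transitivity ((\sum_i x i) ^+ 3 + 3%:R * - 1 * (\sum_i x i)
    * (\sum_i x i ^+ 2) + 2%:R * (\sum_i x i ^+ 3)); last by ring.
rewrite -pattern; apply: eq_bigr => i _; apply: eq_bigr => j _.
apply: eq_bigr => k _; congr (_ * _); rewrite /w -!val_eqE /=.
case: (ltngtP i j) => ij; case: (ltngtP j k) => jk; case: (ltngtP i k) => ik;
  try lia; rewrite /=; ring.
Qed.

End SymmetricSums.

(** * Eigenvalues of the Casimir elements *)

Section CasimirEigenvalues.
Variables (F : comNzRingType) (r : nat).
Implicit Types a s : 'I_r -> F.

(** The recursion of [acts_by_casimir_step]. *)
Definition next_eigen a s (i : 'I_r) : F :=
  a i * s i + \sum_(l < r | (i < l)%N) (s i - s l).

Definition casimir2_eigen a : F := \sum_i next_eigen a a i.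
Definition casimir3_eigen a : F := \sum_i next_eigen a (next_eigen a a) i.

Lemma sum_ord_gt (i : 'I_r) (c : F) :
  \sum_(l < r | (i < l)%N) c = (r%:R - 1 - i%:R) * c.
Proof.
have : \sum_(l < r) c = r%:R * c by rewrite sumr_const card_ord mulr_natl.
rewrite (bigID (fun l : 'I_r => (i < l)%N)) /=.
under [X in _ + X]eq_bigl => l do rewrite -leqNgt -ltnS.
rewrite -(big_ord_widen r (fun=> c) (ltn_ord i)).
move=> /(canRL (addrK _)) ->; rewrite sumr_const card_ord -[c *+ _]mulr_natl -natr1.
ring.
Qed.

Lemma exchange_lt (f : 'I_r -> 'I_r -> F) :
  \sum_(i < r) \sum_(l < r | (i < l)%N) f i l =
  \sum_(l < r) \sum_(i < r | (i < l)%N) f i l.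
Proof. exact: exchange_big_dep. Qed.

Lemma sum_ord_lt (i : 'I_r) (f : nat -> F) :
  \sum_(l < r | (l < i)%N) f l = \sum_(l < i) f l.
Proof. by rewrite -(big_ord_widen r f (ltnW (ltn_ord i))). Qed.

Lemma sum_next_eigen a s : \sum_i next_eigen a s i =
  \sum_i (a i + (r%:R - 1 - 2%:R * i%:R)) * s i.
Proof.
transitivity (\sum_i (a i * s i + (r%:R - 1 - i%:R) * s i - i%:R * s i));
  last first.
  by apply: eq_bigr => i _; ring.
rewrite sumrB /next_eigen; under eq_bigr => i _ do rewrite sumrB sum_ord_gt addrA.
rewrite sumrB exchange_lt; congr (_ - _); apply: eq_bigr => l _.
by rewrite (sum_ord_lt l (fun=> s l)) sumr_const card_ord mulr_natl.
Qed.

Lemma sum_descending (i : nat) :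
  \sum_(l < i) (r%:R - 1 - 2%:R * l%:R) = i%:R * (r%:R - i%:R) :> F.
Proof.
elim: i => [|i IH]; first by rewrite big_ord0 mul0r.
by rewrite big_ord_recr /= IH -natr1; ring.
Qed.

Variable x : 'I_r -> F.
Let P k := \sum_i x i ^+ k.
Let J1 := \sum_(i < r) i%:R * x i.
Let J2 := \sum_(i < r) i%:R ^+ 2 * x i.
Let K := \sum_(i < r) i%:R * x i ^+ 2.

Lemma casimir2_eigenE :
  casimir2_eigen x = P 2 + (r%:R - 1) * P 1 - 2%:R * J1.
Proof.
rewrite /casimir2_eigen sum_next_eigen /P /J1 !mulr_sumr -big_split -sumrB.
by apply: eq_bigr => i _ /=; ring.
Qed.

(** The double sum over [i < l] in [next_eigen x x] is the only part of the
    eigenvalue that is not a sum over one index.  Weighted by [x i] it is the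
    second elementary symmetric function, weighted by the linear factor of
    [sum_next_eigen] it is evaluated by [sum_descending]. *)
Lemma casimir3_eigenE : 2%:R * casimir3_eigen x =
  2%:R * (P 3 + 2%:R * (r%:R - 1) * P 2 - 3%:R * K + (r%:R - 1) ^+ 2 * P 1
    - 3%:R * (r%:R - 1) * J1 + 2%:R * J2 - r%:R * J1 + J2)
  - (P 1 ^+ 2 - P 2).
Proof.
have pairs : P 1 ^+ 2 - P 2 =
    2%:R * (\sum_(i < r) \sum_(l < r | (i < l)%N) x i * x l).
  rewrite sum_lt_pairs => [|i j]; last by rewrite mulrC.
  congr (_ - _); rewrite expr2 /P mulr_suml; apply: eq_bigr => i _.
  by rewrite mulr_sumr.
have tri : \sum_(i < r) \sum_(l < r | (i < l)%N)
    (r%:R - 1 - 2%:R * i%:R) * x l = r%:R * J1 - J2.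
  rewrite exchange_lt /J1 /J2 mulr_sumr -sumrB; apply: eq_bigr => l _.
  rewrite -mulr_suml (sum_ord_lt l (fun i => r%:R - 1 - 2%:R * i%:R)).
  by rewrite sum_descending; ring.
rewrite pairs -mulrBr; congr (_ * _).
rewrite /casimir3_eigen sum_next_eigen.
transitivity (\sum_i ((x i + (r%:R - 1 - 2%:R * i%:R)) *
      (x i ^+ 2 + (r%:R - 1 - i%:R) * x i))
    - (\sum_(i < r) \sum_(l < r | (i < l)%N) x i * x l + (r%:R * J1 - J2))).
  rewrite -tri -big_split -sumrB; apply: eq_bigr => i _ /=.
  rewrite /next_eigen sumrB sum_ord_gt -big_split /=.
  under [in RHS]eq_bigr => l _ do rewrite -mulrDl.
  by rewrite -mulr_sumr; ring.
have -> : \sum_i (x i + (r%:R - 1 - 2%:R * i%:R)) *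
      (x i ^+ 2 + (r%:R - 1 - i%:R) * x i) =
    P 3 + 2%:R * (r%:R - 1) * P 2 - 3%:R * K + (r%:R - 1) ^+ 2 * P 1
      - 3%:R * (r%:R - 1) * J1 + 2%:R * J2.
  rewrite /P /K /J1 /J2 !mulr_sumr -!(sumrB, big_split) /=.
  by apply: eq_bigr => i _; ring.
ring.
Qed.

End CasimirEigenvalues.

Section DeltaDot.
Variables (r : nat) (a : 'X_{1..r}).
Let x (i : 'I_r) : rat := (a i)%:R.
Let P k := \sum_i x i ^+ k.

Lemma sum_ne_pairs : \sum_(i < r) \sum_(j < r | i != j) x i ^+ 2 * x j =
  P 2 * P 1 - P 3.
Proof.
rewrite /P mulr_suml -sumrB; apply: eq_bigr => i _.
rewrite mulr_sumr [X in _ = X - _](bigD1 i) //= -exprD addrAC subrr add0r.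
by apply: eq_bigl => j; rewrite eq_sym.
Qed.

Lemma delta_dot2_casimir :
  delta_dot2 a = r%:R * casimir2_eigen x - P 1 ^+ 2.
Proof.
rewrite /delta_dot2 (@sum_lt_pairs _ _ (fun i j => x i * x j)); last first.
  by move=> i j; rewrite mulrC.
have -> : \sum_i \sum_j x i * x j = P 1 ^+ 2.
  by rewrite expr2 /P mulr_suml; apply: eq_bigr => i _; rewrite mulr_sumr.
have -> : \sum_(i < r) (r%:R + 1 - 2%:R * i.+1%:R) * (a i)%:R =
    (r%:R - 1) * P 1 - 2%:R * (\sum_(i < r) i%:R * x i).
  rewrite /P !mulr_sumr -sumrB; apply: eq_bigr => i _.
  by rewrite -natr1 /x; ring.
have -> : \sum_i x i * x i = P 2 by apply: eq_bigr => i _; rewrite expr2.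
by rewrite casimir2_eigenE -/(P 1) -/(P 2); ring.
Qed.

(** Both sides are combinations of the power sums [P k] and of the sums
    [J1], [J2] and [K].  The right-hand side is the one of [solve_cubic], up to
    the factor [N]. *)
Lemma delta_dot3_casimir : delta_dot3 a =
  2%:R * r%:R ^+ 2 * casimir3_eigen x - r%:R ^+ 3 * casimir2_eigen x
  - 6%:R * r%:R * P 1 * casimir2_eigen x + r%:R ^+ 2 * P 1 ^+ 2
  + 4%:R * P 1 ^+ 3.
Proof.
rewrite /delta_dot3 sum_ne_pairs.
have e3 := sum_lt_triples x; rewrite -/(P 1) -/(P 2) -/(P 3) in e3.
have -> : 24%:R * (\sum_(i < r) \sum_(j < r | (i < j)%N)
    \sum_(k < r | (j < k)%N) x i * x j * x k) =
    4%:R * (P 1 ^+ 3 - 3%:R * P 1 * P 2 + 2%:R * P 3).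
  by rewrite -e3 mulrA -natrM.
pose J1 := \sum_(i < r) i%:R * x i; pose J2 := \sum_(i < r) i%:R ^+ 2 * x i.
pose K := \sum_(i < r) i%:R * x i ^+ 2.
have -> : \sum_(i < r) (r%:R + 1 - 2%:R * i.+1%:R) * (a i)%:R ^+ 2 =
    (r%:R - 1) * P 2 - 2%:R * K.
  rewrite /P /K !mulr_sumr -sumrB; apply: eq_bigr => i _.
  by rewrite -natr1 /x; ring.
have -> : 12%:R * r%:R * (\sum_(i < r) \sum_(j < r | (i < j)%N)
    (r%:R + 1 - i.+1%:R - j.+1%:R) * (a i)%:R * (a j)%:R) =
    6%:R * r%:R * ((r%:R - 1) * P 1 ^+ 2 - 2%:R * P 1 * J1
      - ((r%:R - 1) * P 2 - 2%:R * K)).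
  set T := \sum_(i < r) _; have -> : 12%:R * r%:R * T = 6%:R * r%:R * (2%:R * T).
    by ring.
  rewrite /T (@sum_lt_pairs _ _ (fun i j : 'I_r =>
    (r%:R + 1 - i.+1%:R - j.+1%:R) * (a i)%:R * (a j)%:R)); last first.
    by move=> i j; ring.
  congr (_ * _); congr (_ - _).
    transitivity (\sum_i ((r%:R - 1) * P 1 * x i - P 1 * (i%:R * x i) - J1 * x i)).
      apply: eq_bigr => i _; rewrite /P /J1 mulr_sumr !mulr_suml -!sumrB.
      by apply: eq_bigr => j _; rewrite -!natr1 /x; ring.
    by rewrite !sumrB -!mulr_sumr -/J1 -/(P 1); ring.
  rewrite /P /K !mulr_sumr -sumrB; apply: eq_bigr => i _.
  by rewrite -natr1 /x; ring.
have -> : \sum_(i < r) (6%:R * i.+1%:R ^+ 2 - 6%:R * i.+1%:R * (r%:R + 1)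
      + r%:R ^+ 2 + 3%:R * r%:R + 2%:R) * (a i)%:R =
    6%:R * J2 - 6%:R * (r%:R - 1) * J1 + (r%:R - 1) * (r%:R - 2%:R) * P 1 :> rat.
  rewrite /P /J1 /J2 !mulr_sumr -!(sumrB, big_split) /=.
  by apply: eq_bigr => i _; rewrite -natr1 /x; ring.
rewrite [_ * r%:R ^+ 2]mulrC -[_ * _ * casimir3_eigen x]mulrA casimir3_eigenE.
rewrite casimir2_eigenE -/(P 1) -/(P 2) -/(P 3) -/J1 -/J2 -/K.
ring.
Qed.

End DeltaDot.

Section Solve.
Variables (F : numFieldType) (r N S1 n1 b d c2 : F).
Hypothesis n1E : r * n1 = N * S1.
Hypothesis bE : r * b + d = S1 * n1.
Hypothesis c2E : r ^+ 2 * d + r * b = N * c2.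

(** The unknown [b] is eliminated between [bE] and [c2E], and [n1] by [n1E]. *)
Lemma solve_quadratic : r * ((r - 1) * (r + 1)) * d = N * (r * c2 - S1 ^+ 2).
Proof.
have -> : N * (r * c2 - S1 ^+ 2) = r * (N * c2) - S1 * (N * S1) by ring.
rewrite -c2E -n1E.
have -> : S1 * (r * n1) = r * (S1 * n1) by ring.
by rewrite -bE; ring.
Qed.

Variables (A B E c3 : F).
Hypothesis AE : r * A + 2%:R * B = S1 * b.
Hypothesis BE : r * B + E = S1 * d.
Hypothesis c3E : r ^+ 3 * ((E + d) / 2%:R) + 3%:R * r ^+ 2 * B
  + r * (A + (E - d) / 2%:R) = N * c3.

(** By [AE] and [BE] the unknowns [A] and [B] are linear in [E]; substituted in
    [c3E] they leave one linear equation for [E], whose leading coefficient is,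
    up to a factor, [(r ^+ 2 - 1) * (r ^+ 2 - 4)]. *)
Lemma solve_cubic :
  r * ((r - 2%:R) * (r - 1) * (r + 1) * (r + 2%:R)) * E =
  N * (2%:R * r ^+ 2 * c3 - r ^+ 3 * c2 - 6%:R * r * S1 * c2
       + r ^+ 2 * S1 ^+ 2 + 4%:R * S1 ^+ 3).
Proof.
have -> : N * (2%:R * r ^+ 2 * c3 - r ^+ 3 * c2 - 6%:R * r * S1 * c2
       + r ^+ 2 * S1 ^+ 2 + 4%:R * S1 ^+ 3) =
  2%:R * r ^+ 2 * (N * c3) - 2%:R * r * S1 * (N * c2)
  - (r ^+ 2 + 4%:R * S1) * (N * (r * c2 - S1 ^+ 2)) by ring.
rewrite -solve_quadratic -c3E -c2E.
have -> : 2%:R * r * S1 * (r ^+ 2 * d + r * b) =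
  2%:R * r ^+ 3 * (S1 * d) + 2%:R * r ^+ 2 * (S1 * b) by ring.
have -> : (r ^+ 2 + 4%:R * S1) * (r * ((r - 1) * (r + 1)) * d) =
  r ^+ 3 * ((r - 1) * (r + 1)) * d
  + 4%:R * r * ((r - 1) * (r + 1)) * (S1 * d) by ring.
by rewrite -AE -BE; field.
Qed.

End Solve.

(** * Moments of the weights *)

Section Moments.
Variables (C : numFieldType) (r n : nat) (Q : 'M[{mpoly C[r * r]}]_n).
Hypothesis value1 : value Q 1%:M = 1%:M.
Hypothesis valueM : forall g h, g \in unitmx -> h \in unitmx ->
  value Q (g *m h) = value Q g *m value Q h.

(** A sum over the weights counted with multiplicity: the ranks are the
    dimensions of the weight spaces. *)
Definition weight_sum (f : 'X_{1..r} -> rat) : rat :=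
  \sum_(m : 'X_{1..r < weight_bound Q}) (\rank (weight_proj Q m))%:R * f m.

Definition moment1 i := weight_sum (fun m => (m i)%:R).
Definition moment2 i j := weight_sum (fun m => (m i)%:R * (m j)%:R).
Definition moment3 i j k := weight_sum (fun m => (m i)%:R * (m j)%:R * (m k)%:R).

Let e (i j : 'I_r) : 'M[C]_n := dvalue Q (delta_mx i j).

Lemma mxtrace_weight_sum (f : 'X_{1..r} -> rat) :
  \tr (\sum_(m : 'X_{1..r < weight_bound Q}) ratr (f m) *: weight_proj Q m) =
  ratr (weight_sum f) :> C.
Proof.
rewrite raddf_sum rmorph_sum; apply: eq_bigr => m _ /=.
by rewrite mxtraceZ mxtrace_weight_proj // rmorphM /= ratr_nat mulrC.
Qed.

Lemma weight_sum1 : weight_sum (fun=> 1) = n%:R.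
Proof.
apply: (@fmorph_inj _ _ (ratr : {rmorphism rat -> C})) => /=.
rewrite -mxtrace_weight_sum ratr_nat -mxtrace1 -(sum_weight_proj value1).
by congr (\tr _); apply: eq_bigr => m _; rewrite rmorph1 scale1r.
Qed.

Let e_diag i : e i i = \sum_(m : 'X_{1..r < weight_bound Q})
  (m i)%:R *: weight_proj Q m.
Proof. exact: dvalue_torus. Qed.

Let e_diag2 i j : e i i *m e j j = \sum_(m : 'X_{1..r < weight_bound Q})
  ((m i)%:R * (m j)%:R) *: weight_proj Q m.
Proof.
by rewrite !e_diag (mul_weight_sums valueM (fun m => (m i)%:R) (fun m => (m j)%:R)).
Qed.

Lemma mxtrace_moment1 i : \tr (e i i) = ratr (moment1 i).
Proof.
rewrite -mxtrace_weight_sum e_diag; congr (\tr _).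
by apply: eq_bigr => m _; rewrite ratr_nat.
Qed.

Lemma mxtrace_moment2 i j : \tr (e i i *m e j j) = ratr (moment2 i j).
Proof.
rewrite -mxtrace_weight_sum e_diag2; congr (\tr _).
by apply: eq_bigr => m _; rewrite rmorphM /= !ratr_nat.
Qed.

Lemma mxtrace_moment3 i j k :
  \tr (e i i *m e j j *m e k k) = ratr (moment3 i j k).
Proof.
rewrite -mxtrace_weight_sum e_diag2 e_diag.
rewrite (mul_weight_sums valueM (fun m => (m i)%:R * (m j)%:R)
  (fun m => (m k)%:R)).
by congr (\tr _); apply: eq_bigr => m _; rewrite !rmorphM /= !ratr_nat.
Qed.

Let ratrI : injective (ratr : rat -> C).
Proof. exact: (@fmorph_inj _ _ (ratr : {rmorphism rat -> C})). Qed.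

Let ratrD x y : ratr (x + y) = ratr x + ratr y :> C. Proof. exact: rmorphD. Qed.
Let ratrB x y : ratr (x - y) = ratr x - ratr y :> C. Proof. exact: rmorphB. Qed.
Let ratrM x y : ratr (x * y) = ratr x * ratr y :> C. Proof. exact: rmorphM. Qed.

Lemma moment1_const : exists n1, forall i, moment1 i = n1.
Proof.
apply: perm_invariant1 => s i; apply: ratrI.
by rewrite -!mxtrace_moment1 mxtrace_perm1.
Qed.

Lemma moment2_pattern : (1 < r)%N ->
  exists b d, forall i j, moment2 i j = b + d * (i == j)%:R.
Proof.
move=> r1; apply: perm_invariant2 => // s i j; apply: ratrI.
by rewrite -!mxtrace_moment2 mxtrace_perm2.
Qed.

Lemma moment3_pattern : (2 < r)%N -> exists A B E, forall i j k,
  moment3 i j k = A + B * ((i == j)%:R + (j == k)%:R + (i == k)%:R)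
      + E * ((i == j)%:R * (j == k)%:R).
Proof.
move=> r2; apply: perm_invariant3 => // [s i j k|i j k|i j k].
- by apply: ratrI; rewrite -!mxtrace_moment3 mxtrace_perm3.
- by apply: eq_bigr => m _; rewrite [(m i)%:R * (m j)%:R]mulrC.
- by apply: eq_bigr => m _; rewrite mulrAC.
Qed.

Variable a : 'I_r -> rat.
Let S1 := \sum_i a i.
Let N : rat := n%:R.

Hypothesis trace_scalar : dvalue Q 1%:M = (ratr S1)%:M.
Hypothesis casimir2_scalar :
  casimir_step Q (dvalue Q) 1%:M = (ratr (casimir2_eigen a))%:M.
Hypothesis casimir3_scalar :
  casimir_step Q (casimir_step Q (dvalue Q)) 1%:M =
  (ratr (casimir3_eigen a))%:M.

Let sum_e_diag : \sum_i e i i = (ratr S1)%:M.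
Proof.
rewrite -trace_scalar [1%:M]matrix_sum_delta linear_sum; apply: eq_bigr => i _.
rewrite linear_sum (bigD1 i) //= mxE eqxx scale1r big1 ?addr0 // => j ji.
by rewrite mxE eq_sym (negPf ji) scale0r linear0.
Qed.

Lemma moment1_sum : \sum_i moment1 i = N * S1.
Proof.
apply: ratrI; rewrite rmorph_sum rmorphM /= ratr_nat /=.
under eq_bigr => i _ do rewrite -mxtrace_moment1.
by rewrite -raddf_sum /= sum_e_diag mxtrace_scalar mulr_natl.
Qed.

Lemma moment2_sum i : \sum_j moment2 i j = S1 * moment1 i.
Proof.
apply: ratrI; rewrite rmorph_sum rmorphM /=.
under eq_bigr => j _ do rewrite -mxtrace_moment2.
rewrite -raddf_sum -mulmx_sumr sum_e_diag /= mul_mx_scalar mxtraceZ.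
by rewrite mxtrace_moment1.
Qed.

Lemma moment3_sum i j : \sum_k moment3 i j k = S1 * moment2 i j.
Proof.
apply: ratrI; rewrite rmorph_sum rmorphM /=.
under eq_bigr => k _ do rewrite -mxtrace_moment3.
rewrite -raddf_sum -mulmx_sumr sum_e_diag /= mul_mx_scalar mxtraceZ.
by rewrite mxtrace_moment2.
Qed.

Section QuadraticPattern.
Variables n1 b d : rat.
Hypothesis n1P : forall i, moment1 i = n1.
Hypothesis bdP : forall i j, moment2 i j = b + d * (i == j)%:R.

Lemma first_moment_relation : r%:R * n1 = N * S1.
Proof.
rewrite -moment1_sum; under eq_bigr do rewrite n1P.
by rewrite sumr_const card_ord mulr_natl.
Qed.

Lemma second_moment_relation : (0 < r)%N -> r%:R * b + d = S1 * n1.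
Proof.
move=> r0; rewrite -(n1P (Ordinal r0)) -moment2_sum.
under eq_bigr do rewrite bdP [d * _]mulrC.
by rewrite big_split sum_delta sumr_const card_ord mulr_natl.
Qed.

Lemma mxtrace_quadratic i j : \tr (e i j *m e j i) = ratr (d + b * (i == j)%:R).
Proof.
have [<-|ij] := eqVneq i j.
  by rewrite mxtrace_moment2 bdP eqxx !mulr1 addrC.
rewrite (mxtrace_root_pair value1 valueM ij) !mxtrace_moment2 !bdP eqxx (negPf ij).
by rewrite -ratrB; congr ratr; rewrite /=; ring.
Qed.

Lemma casimir2_relation : r%:R ^+ 2 * d + r%:R * b = N * casimir2_eigen a.
Proof.
have := mxtrace_casimir2 Q; rewrite casimir2_scalar mxtrace_scalar.
under eq_bigr => i _ do (under eq_bigr => j _ do rewrite mxtrace_quadratic;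
  rewrite -rmorph_sum).
rewrite -rmorph_sum -[_ *+ n]mulr_natl -(ratr_nat C n).
rewrite -ratrM => /ratrI ->.
have := sum_pattern2 (fun=> 1 : rat) d b (r := r); rewrite !expr1n !sumr_const card_ord.
move=> pattern_sum; transitivity (d * r%:R ^+ 2 + b * r%:R); first by ring.
rewrite -pattern_sum; apply: eq_bigr => i _; apply: eq_bigr => j _.
by rewrite !mulr1.
Qed.

Variables A B E : rat.
Hypothesis ABEP : forall i j k,
  moment3 i j k = A + B * ((i == j)%:R + (j == k)%:R + (i == k)%:R)
      + E * ((i == j)%:R * (j == k)%:R).

(** [moment3_sum] in terms of the coefficients of the two patterns. *)
Let moment3_row (i j : 'I_r) : S1 * (b + d * (i == j)%:R) =
  r%:R * (A + B * (i == j)%:R) + 2%:R * B + E * (i == j)%:R.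
Proof.
rewrite -bdP -moment3_sum; under eq_bigr => k _ do rewrite ABEP.
transitivity (\sum_(k < r) ((A + B * (i == j)%:R) + (j == k)%:R * B
    + (i == k)%:R * B + (j == k)%:R * (E * (i == j)%:R))).
  by apply: eq_bigr => k _; ring.
rewrite !big_split /= !sum_delta !sumr_const card_ord -[A *+ r]mulr_natl.
by rewrite -[(B * _) *+ r]mulr_natl; ring.
Qed.

Lemma third_moment_relation : (1 < r)%N -> r%:R * A + 2%:R * B = S1 * b.
Proof.
move=> r1; have := moment3_row (Ordinal (ltnW r1)) (Ordinal r1).
by rewrite /= !mulr0 !addr0.
Qed.

Lemma third_moment_diag_relation : (1 < r)%N -> r%:R * B + E = S1 * d.
Proof.
move=> r1; have := moment3_row (Ordinal r1) (Ordinal r1).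
rewrite eqxx !mulr1 => row11; have -> : S1 * d = S1 * (b + d) - S1 * b by ring.
by rewrite row11 -(third_moment_relation r1); ring.
Qed.

(** Up to cyclic rotation the indices are all equal, of the form [(i, i, k)] or
    distinct; the last two cases are [mxtrace_diag_root_pair] and
    [mxtrace_three_cycle]. *)
Lemma mxtrace_cubic (i j k : 'I_r) : \tr (e i j *m e j k *m e k i) =
  ratr ((E + d) / 2%:R + B * ((i == j)%:R + (j == k)%:R + (i == k)%:R)
        + (A + (E - d) / 2%:R) * ((i == j)%:R * (j == k)%:R)).
Proof.
have diag x y : x != y ->
    \tr (e x x *m e x y *m e y x) = ratr ((E + d) / 2%:R + B).
  move=> xy; apply: (mulIf (_ : 2%:R != 0)); first by rewrite pnatr_eq0.
  rewrite mulr_natr (mxtrace_diag_root_pair value1 valueM xy).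
  rewrite !mxtrace_moment2 !mxtrace_moment3 !bdP !ABEP eqxx (negPf xy).
  rewrite -(ratr_nat C 2) -!(ratrB, ratrD, ratrM).
  by congr ratr; rewrite /=; field.
have [<-|ij] := eqVneq i j.
  have [<-|ik] := eqVneq i k.
    by rewrite mxtrace_moment3 ABEP eqxx /=; congr ratr; rewrite /=; field.
  by rewrite diag //=; congr ratr; rewrite /=; ring.
have [<-|jk] := eqVneq j k.
  rewrite (negPf ij) mxtrace_mulC mulmxA mxtrace_mulC mulmxA diag 1?eq_sym //=.
  by congr ratr; rewrite /=; ring.
have [<-|ik] := eqVneq i k.
  by rewrite mxtrace_mulC mulmxA diag //=; congr ratr; rewrite /=; ring.
rewrite (mxtrace_three_cycle value1 valueM ij jk ik) diag //.
rewrite (mxtrace_diag_disjoint_pair value1 valueM ij jk ik) !mxtrace_moment3 !ABEP.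
rewrite eqxx (negPf ij) (negPf jk) (negPf ik) -!ratrB.
by congr ratr; rewrite /=; ring.
Qed.

Lemma casimir3_relation : r%:R ^+ 3 * ((E + d) / 2%:R) + 3%:R * r%:R ^+ 2 * B
  + r%:R * (A + (E - d) / 2%:R) = N * casimir3_eigen a.
Proof.
have := mxtrace_casimir3 Q; rewrite casimir3_scalar mxtrace_scalar.
under eq_bigr => i _ do (under eq_bigr => j _ do
  (under eq_bigr => k _ do rewrite mxtrace_cubic; rewrite -rmorph_sum);
  rewrite -rmorph_sum).
rewrite -rmorph_sum -[_ *+ n]mulr_natl -(ratr_nat C n).
rewrite -ratrM => /ratrI ->.
have := sum_pattern3 (fun=> 1 : rat) ((E + d) / 2%:R) B (A + (E - d) / 2%:R)
  (r := r).
rewrite !expr1n !sumr_const card_ord.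
move=> pattern_sum; transitivity ((E + d) / 2%:R * r%:R ^+ 3
  + 3%:R * B * r%:R * r%:R + (A + (E - d) / 2%:R) * r%:R); first by ring.
rewrite -pattern_sum; apply: eq_bigr => i _; apply: eq_bigr => j _.
by apply: eq_bigr => k _; rewrite !mulr1.
Qed.

End QuadraticPattern.
End Moments.

(** * Abstract representations in coordinates *)

Section MatrixOfRepresentation.
Import VectorInternalTheory.
Variables (C : numFieldType) (r : nat) (W : vectType C).
Variable rho : 'M[C]_r -> 'End(W).
Local Notation n := (dim W).
Implicit Types (f : 'End(W)) (w : W).

Definition coord_col w : 'cV[C]_n := (v2r w)^T.

(** Transposed, because coordinates are rows while the representation is to act
    on columns from the left. *)
Definition mx_of_end f : 'M[C]_n := (lin1_mx (v2r \o f \o r2v))^T.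

Lemma mul_mx_of_end f w : mx_of_end f *m coord_col w = coord_col (f w).
Proof. by rewrite -trmx_mul mul_rV_lin1 /= v2rK. Qed.

Lemma coord_col_inj : injective coord_col.
Proof. by move=> u w /trmx_inj/v2r_inj. Qed.

Lemma coord_col_eq0 w : (coord_col w == 0) = (w == 0).
Proof. by rewrite -(inj_eq coord_col_inj) /coord_col linear0 trmx0. Qed.

Lemma coord_col_surj (v : 'cV[C]_n) : exists w, v = coord_col w.
Proof. by exists (r2v v^T); rewrite /coord_col r2vK trmxK. Qed.

Lemma coord_colZ c w : coord_col (c *: w) = c *: coord_col w.
Proof. by rewrite /coord_col !linearZ. Qed.

Lemma eq_mx_on_coord (A B : 'M[C]_n) :
  (forall w, A *m coord_col w = B *m coord_col w) -> A = B.
Proof.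
move=> AB; apply/matrixP => i j.
have [w wE] := coord_col_surj (delta_mx j 0).
by have /matrixP/(_ i 0) := AB w; rewrite -wE -!colE !mxE.
Qed.

Definition matrix_repr (Q : 'M[{mpoly C[r * r]}]_n) : Prop :=
  forall g w, g \in unitmx -> value Q g *m coord_col w = coord_col (rho g w).

Lemma exists_matrix_repr : polynomial_rep rho -> exists Q, matrix_repr Q.
Proof.
case=> _ _ rho_coef.
have entry (ab : 'I_n * 'I_n) : exists p : {mpoly C[r * r]}, forall g,
    g \in unitmx -> mx_of_end (rho g) ab.1 ab.2 = p.@[fun k => mxvec g 0 k].
  case: ab => a b /=; pose phi := fun w => v2r w 0 a : C^o.
  have phi_lin : linear phi by move=> c u w; rewrite /phi linearP !mxE.
  pose lphi := GRing.isLinear.Build C W C^o _ phi phi_lin.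
  pose philin : {linear W -> C^o} := HB.pack phi lphi.
  have [p pE] := rho_coef (linfun philin) (r2v (delta_mx 0 b)).
  exists p => g gU; rewrite -pE // lfunE /= /phi !mxE /=.
  by [].
have [q qE] := fin_all_exists entry.
exists (\matrix_(a, b) q (a, b)) => g w gU; rewrite -mul_mx_of_end.
congr (_ *m _); apply/matrixP => a b.
by rewrite (qE (a, b) g gU) mxE mxE.
Qed.

Variable Q : 'M[{mpoly C[r * r]}]_n.
Hypothesis rho_poly : polynomial_rep rho.
Hypothesis QE : matrix_repr Q.

Lemma repr_value1 : value Q 1%:M = 1%:M.
Proof.
apply: eq_mx_on_coord => w.
by rewrite QE ?unitmx1 // (polynomial_rep1 rho_poly) mul1mx lfunE.
Qed.

Lemma repr_valueM g h : g \in unitmx -> h \in unitmx ->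
  value Q (g *m h) = value Q g *m value Q h.
Proof.
move=> gU hU; apply: eq_mx_on_coord => w.
rewrite QE ?unitmx_mul ?gU // (polynomial_repM rho_poly) //.
by rewrite -mulmxA !QE // lfunE.
Qed.

Lemma torus_eltE (t : 'rV[C]_r) : diag_mx t = torus_elt (fun i => t 0 i).
Proof. by congr diag_mx; apply/rowP => i; rewrite mxE. Qed.

(** A weight vector of weight [l] is one on which only the character [l]
    contributes to the action of the torus. *)
Lemma weight_vectorP l w : is_weight_vector rho l w <->
  weight_proj Q l *m coord_col w = coord_col w.
Proof.
split=> [wl|wl t t0].
  apply: weight_projE => t t0.
  rewrite QE ?torus_elt_unit // -coord_colZ; congr coord_col.
  rewrite (wl (\row_i t i)) => [|i]; last by rewrite mxE.
  by congr (_ *: _); apply: eq_bigr => i _; rewrite mxE.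
apply: coord_col_inj; rewrite torus_eltE -QE ?torus_elt_unit // -wl mulmxA.
by rewrite (torus_weight_proj repr_valueM) // -scalemxAl wl coord_colZ.
Qed.

Lemma dim_weight_space l :
  \dim (weight_space rho l) = \rank (weight_proj Q l).
Proof.
suff -> : weight_space rho l = mx2vs (weight_proj Q l)^T.
  by rewrite /dimv mx2vsK mxrank_tr.
apply/vspaceP => w; apply/idP/idP.
  move/mem_weight_space/weight_vectorP => wl.
  rewrite memvE /subsetv !mx2vsK -[v2r w]trmxK -/(coord_col w) -wl trmx_mul.
  exact: submxMl.
rewrite memvE /subsetv !mx2vsK => /submxP[D wD].
apply/mem_weight_space/weight_vectorP; rewrite /coord_col wD trmx_mul trmxK.
by rewrite mulmxA (mul_weight_proj repr_valueM) eqxx scale1r.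
Qed.

Lemma ch_weight_proj k : ch rho k = \sum_(m : 'X_{1..r < weight_bound Q})
  ((\rank (weight_proj Q m))%:R / (k`!)%:R : rat) *:
  (\sum_(i < r) (m i)%:R *: 'X_i) ^+ k.
Proof.
pose s := [seq val m | m <- enum {: 'X_{1..r < weight_bound Q}}].
rewrite /ch (fsbigE s) //=; last 2 first.
- by rewrite map_inj_uniq ?enum_uniq //; apply: val_inj.
- move=> l _ ls; rewrite dim_weight_space weight_proj_out ?mxrank0 ?mul0r ?scale0r //.
  rewrite leqNgt; apply: contra ls => lB; apply/mapP.
  by exists (BMultinom lB); rewrite ?mem_enum.
under eq_bigl do rewrite in_setT.
rewrite big_map big_enum; apply: eq_bigr => m _ /=.
by rewrite dim_weight_space.
Qed.

Section Irreducible.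
Hypothesis rho_irr : irreducible_rep rho.

(** Schur's lemma: the eigenspace of [Z] through [v] is a nonzero invariant
    subspace. *)
Lemma commuting_scalar (Z : 'M[C]_n) c (v : 'cV[C]_n) : v != 0 ->
  (forall g, g \in unitmx -> value Q g *m Z = Z *m value Q g) ->
  Z *m v = c *: v -> Z = c%:M.
Proof.
move=> v0 comm Zv; pose U : {vspace W} := mx2vs (kermx (Z - c%:M)^T).
have memU w : (w \in U) = (Z *m coord_col w == c *: coord_col w).
  rewrite memvE /subsetv !mx2vsK sub_kermx -{1}[v2r w]trmxK -trmx_mul trmx_eq0.
  by rewrite mulmxBl mul_scalar_mx subr_eq0.
have [w wE] := coord_col_surj v.
have [_ /(_ U)] := rho_irr; case.
- move=> g gU; apply/subvP => _ /memv_imgP[u uU ->]; move: uU; rewrite !memU.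
  move=> /eqP Zu; rewrite -QE // mulmxA -comm // -mulmxA Zu.
  by rewrite -scalemxAr.
- move=> U0; have : w \in U by rewrite memU -wE Zv.
  by rewrite U0 memv0 -coord_col_eq0 -wE (negPf v0).
move=> Ufull; apply: eq_mx_on_coord => u.
by have := memvf u; rewrite -Ufull memU mul_scalar_mx => /eqP.
Qed.

Section HighestWeightVector.
Variable alpha : 'X_{1..r}.
Hypothesis rho_hw : has_highest_weight rho alpha.

Let a (i : 'I_r) : rat := (alpha i)%:R.
Let aC (i : 'I_r) : C := (alpha i)%:R.

(** The one-parameter groups [1 + t delta_mx i j] fix the highest weight vector
    for [i < j] and multiply it by [(1 + t) ^+ alpha i] for [i = j]; take linear
    parts. *)
Lemma exists_highest_vector : exists2 v : 'cV[C]_n, v != 0 &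
  acts_by v (dvalue Q) aC.
Proof.
have [w [w0 /mem_weight_space wa wu]] := rho_hw.
exists (coord_col w); first by rewrite coord_col_eq0.
split=> [i j ij|i].
  rewrite (@dvalue_eigen _ _ _ _ _ _ 1 1) ?oner_eq0 // => [|t _].
    by rewrite coef1 scale0r.
  rewrite hornerC scale1r QE ?wu //.
  - have ord_ltn_eqF (x y : 'I_r) : (x < y)%N -> (x == y) = false.
      by move=> xy; apply/negbTE; rewrite neq_ltn xy.
    apply/is_trig_mxP => k l kl; rewrite !mxE [l == k]eq_sym ord_ltn_eqF //.
    rewrite add0r; case: (l =P i) => [li|_]; last by rewrite mulr0.
    case: (k =P j) => [kj|_]; last by rewrite mulr0.
    by move: kl; rewrite li kj ltnNge (ltnW ij).
  - move=> k; rewrite !mxE eqxx; case: (k =P i) => [->|_]; last by rewrite mulr0 addr0.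
    by have := ltn_eqF ij; rewrite val_eqE => ->; rewrite mulr0 addr0.
  suff /mulmx1_unit[] : (1%:M + t *: delta_mx i j) *m
    (1%:M - t *: delta_mx i j) = 1%:M :> 'M[C]_r by [].
  rewrite mulmxDl !mulmxBr !mul1mx mulmx1 -scalemxAl -scalemxAr.
  by rewrite mul_delta_mx_0 ?scaler0 ?subr0 ?subrK // neq_ltn ij orbT.
rewrite (@dvalue_eigen _ _ _ _ _ _ (1 + 'X) ((1 + 'X) ^+ alpha i)).
- by rewrite coef1_expr1DX.
(* The value [t = -1] is excluded, where [1 + t delta_mx i i] is singular. *)
- by rewrite addrC -[1]opprK -polyC1 -polyCN polyXsubC_eq0.
move=> t; rewrite hornerD hornerX hornerC => t1.
pose u (j : 'I_r) : C := 1 + (j == i)%:R * t.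
have u0 j : u j != 0.
  rewrite /u; case: (j == i); rewrite ?mul1r // mul0r addr0.
  exact: oner_neq0.
rewrite one_plus_delta QE ?torus_elt_unit // wa => [|j]; last first.
  by rewrite mxE; apply: u0.
rewrite coord_colZ horner_exp hornerD hornerX hornerC -(prod_one_plus i).
by congr (_ *: _); apply: eq_bigr => j _; rewrite mxE.
Qed.

Lemma ratr_next_eigen (s : 'I_r -> rat) i :
  ratr (next_eigen a s i) = next_eigen aC (fun i => ratr (s i)) i.
Proof.
rewrite /next_eigen rmorphD rmorphM rmorph_sum /= ratr_nat; congr (_ + _).
by apply: eq_bigr => l _; rewrite rmorphB.
Qed.

Lemma casimir_scalars : [/\ dvalue Q 1%:M = (ratr (\sum_i a i))%:M,
  casimir_step Q (dvalue Q) 1%:M = (ratr (casimir2_eigen a))%:M &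
  casimir_step Q (casimir_step Q (dvalue Q)) 1%:M =
    (ratr (casimir3_eigen a))%:M].
Proof.
have [v v0 act1] := exists_highest_vector; have [raise_v torus_v] := act1.
have eq1 := dvalue_equivariant repr_valueM.
have eq2 := casimir_step_equivariant repr_valueM eq1.
have eq3 := casimir_step_equivariant repr_valueM eq2.
have act2 := acts_by_casimir_step repr_value1 raise_v torus_v eq1 act1.
have act3 := acts_by_casimir_step repr_value1 raise_v torus_v eq2 act2.
have aE : (fun i => ratr (a i)) = aC by apply/funext => i; rewrite ratr_nat.
split; apply: (commuting_scalar v0);
  try (by move=> g gU; apply: equivariant_central).
- rewrite (acts_by_central act1) rmorph_sum; congr (_ *: _).
  by apply: eq_bigr => i _; rewrite /= ratr_nat.
- rewrite (acts_by_central act2) rmorph_sum; congr (_ *: _).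
  by apply: eq_bigr => i _; rewrite /= ratr_next_eigen aE.
rewrite (acts_by_central act3) rmorph_sum; congr (_ *: _).
apply: eq_bigr => i _; rewrite /= ratr_next_eigen; congr (next_eigen _ _ i).
by apply/funext => l; rewrite ratr_next_eigen aE.
Qed.

End HighestWeightVector.
End Irreducible.
End MatrixOfRepresentation.

(** * The Chern character *)

Section ChernCharacterPattern.
Variables (C : fieldType) (r : nat) (W : vectType C).
Variable rho : 'M[C]_r -> 'End(W).

Definition psum k : {mpoly rat[r]} := \sum_(i < r) 'X_i ^+ k.

(** The shape of the Chern character in degree at most two when the weights
    have symmetric moments [N], [n1] and [b + d * (i == j)].  The factorials are
    cleared so that no constants need to be inverted among polynomials. *)
Definition ch_pattern2 (N n1 b d : rat) : Prop :=
  [/\ ch rho 0 = N%:MP, ch rho 1 = n1%:MP * psum 1 &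
      2%:R * ch rho 2 = b%:MP * psum 1 ^+ 2 + d%:MP * psum 2].

(** Likewise in degree three. *)
Definition ch_pattern3 (A B E : rat) : Prop :=
  6%:R * ch rho 3 = A%:MP * psum 1 ^+ 3 + 3%:R * B%:MP * psum 1 * psum 2
    + E%:MP * psum 3.

Lemma d2_pattern N n1 b d : N != 0 -> ch_pattern2 N n1 b d ->
  d2 rho = ((n1 ^+ 2 - N * b) / (2%:R * N))%:MP * psum 1 ^+ 2
    - (d / 2%:R)%:MP * psum 2.
Proof.
move=> N0 [ch0E ch1E ch2E].
have -> : d2 rho = ((2%:R * N)^-1)%:MP * Delta2 rho.
  by rewrite mul_mpolyC /d2 /ch0 ch0E mcoeffC eqxx mulr1.
have -> : Delta2 rho = (n1 ^+ 2 - N * b)%:MP * psum 1 ^+ 2 - (N * d)%:MP * psum 2.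
  rewrite /Delta2 mulrAC ch2E ch0E ch1E mpolyCB !mpolyCM; ring.
have e1 : (n1 ^+ 2 - N * b) / (2%:R * N) = (2%:R * N)^-1 * (n1 ^+ 2 - N * b).
  by rewrite mulrC.
have e2 : d / 2%:R = (2%:R * N)^-1 * (N * d) by field.
by rewrite e1 e2 mulrBr !mpolyCM !mulrA.
Qed.

Lemma d3_pattern N n1 b d A B E : N != 0 -> ch_pattern2 N n1 b d ->
  ch_pattern3 A B E -> d3 rho =
  ((2%:R * n1 ^+ 3 - 3%:R * N * n1 * b + N ^+ 2 * A) / (6%:R * N ^+ 2))%:MP
    * psum 1 ^+ 3
  + ((N * B - n1 * d) / (2%:R * N))%:MP * (psum 1 * psum 2)
  + (E / 6%:R)%:MP * psum 3.
Proof.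
move=> N0 [ch0E ch1E ch2E] ch3E.
have -> : d3 rho = ((6%:R * N ^+ 2)^-1)%:MP * (2%:R * Delta3 rho).
  have -> : 2%:R * Delta3 rho = (2%:R : rat) *: Delta3 rho.
    by rewrite scaler_nat mulr_natl.
  rewrite mul_mpolyC scalerA /d3 /ch0 ch0E mcoeffC eqxx mulr1.
  by congr (_ *: _); field.
have -> : 2%:R * Delta3 rho =
    (2%:R * n1 ^+ 3 - 3%:R * N * n1 * b + N ^+ 2 * A)%:MP * psum 1 ^+ 3
    + (3%:R * N * (N * B - n1 * d))%:MP * (psum 1 * psum 2)
    + (N ^+ 2 * E)%:MP * psum 3.
  have -> : 2%:R * Delta3 rho = 2%:R * ch rho 1 ^+ 3
      - 3%:R * ch rho 0 * ch rho 1 * (2%:R * ch rho 2)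
      + ch rho 0 ^+ 2 * (6%:R * ch rho 3) by rewrite /Delta3; ring.
  rewrite ch3E ch2E ch0E ch1E; ring.
set c := ((6%:R * N ^+ 2)^-1)%:MP.
have split_c (u v : rat) : u = (6%:R * N ^+ 2)^-1 * v -> u%:MP = c * v%:MP.
  by move=> ->; apply: mpolyCM.
rewrite (split_c _ _ (mulrC _ _)).
rewrite (split_c ((N * B - n1 * d) / _) (3%:R * N * (N * B - n1 * d))).
  rewrite (split_c (E / 6%:R) (N ^+ 2 * E)); last by field.
  by rewrite !mulrDr !mulrA.
by field.
Qed.

End ChernCharacterPattern.

Section StandardRepresentation.
Variables (C : numFieldType) (r : nat).

(** Test with the torus elements that have a [2] in one place and [1]
    elsewhere: the powers of [2] determine their exponents. *)
Lemma std_weight_vector (l : 'X_{1..r}) (w : 'cV[C]_r) (j : 'I_r) :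
  is_weight_vector (std C r) l w -> w j 0 != 0 -> l = U_(j)%MM.
Proof.
move=> wl wj; apply/mnmP => k; rewrite mnm1E.
pose t := \row_(i < r) (if i == k then 2%:R else 1 : C).
have t0 i : t 0 i != 0.
  by rewrite mxE; case: ifP; rewrite ?pnatr_eq0 ?oner_eq0.
have := wl t t0; rewrite lfunE /= => /matrixP/(_ j 0).
rewrite mul_diag_mx [LHS]mxE [RHS]mxE => /(mulIf wj).
rewrite mxE (bigD1 k) //= big1.
  rewrite mxE eqxx mulr1 -natrX; case: (j == k) => /= /eqP.
    by rewrite eqr_nat -{1}[2%N]expn1 eqn_exp2l // => /eqP.
  by rewrite -[1]/(1%:R) eqr_nat -{1}(expn0 2) eqn_exp2l // => /eqP.
by move=> i ik; rewrite mxE (negPf ik) expr1n.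
Qed.

Lemma std_weight_space (i : 'I_r) :
  weight_space (std C r) U_(i) = <[(delta_mx i 0)%R]>%VS.
Proof.
apply/vspaceP => w; apply/idP/vlineP.
  move/mem_weight_space => wi; exists (w i 0); apply/matrixP => j k.
  rewrite !mxE ord1 eqxx andbT; have [->|ji] := eqVneq j i; first by rewrite mulr1.
  rewrite mulr0; apply/eqP; apply: contraNT ji => wj.
  by rewrite -eq_mnm1 -(std_weight_vector wi wj).
case=> c ->; apply/mem_weight_space => t _; rewrite lfunE /= -scalemxAr.
rewrite [RHS]scalerA mulrC -scalerA; congr (_ *: _); apply/matrixP => j k.
rewrite mul_diag_mx !mxE (bigD1 i) //= mnm1E eqxx expr1 big1 ?mulr1.
  by case: (j =P i) => [->//|_]; rewrite !mulr0.
by move=> l li; rewrite mnm1E eq_sym (negPf li).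
Qed.

Lemma ch_std k : ch (std C r) k = \sum_(i < r) ((k`!)%:R^-1 : rat) *: 'X_i ^+ k.
Proof.
pose s : seq 'X_{1..r} := [seq U_(i)%MM | i <- enum 'I_r].
rewrite /ch (fsbigE s) //=; last 2 first.
- by rewrite map_inj_uniq ?enum_uniq // => i j /eqP; rewrite eq_mnm1 => /eqP.
- move=> l _ ls; suff -> : weight_space (std C r) l = 0%VS.
    by rewrite dimv0 mul0r scale0r.
  apply/vspaceP => w; rewrite memv0; apply/idP/eqP => [|->]; last exact: mem0v.
  move/mem_weight_space => wl; apply/matrixP => j z; rewrite ord1 mxE.
  apply/eqP; apply: contraNT ls => wj; apply/mapP; exists j; rewrite ?mem_enum //.
  exact: std_weight_vector wl wj.
under eq_bigl do rewrite in_setT.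
rewrite big_map big_enum; apply: eq_bigr => i _ /=.
rewrite std_weight_space dim_vline.
have -> : (delta_mx i 0 : 'cV[C]_r) != 0.
  by apply/eqP => /matrixP/(_ i 0)/eqP; rewrite !mxE !eqxx oner_eq0.
rewrite mul1r; congr (_ *: _ ^+ k).
rewrite (bigD1 i) //= mnm1E eqxx scale1r big1 ?addr0 // => j ji.
by rewrite mnm1E eq_sym (negPf ji) scale0r.
Qed.

Lemma natr_mul_ch_std k : (k`!)%:R * ch (std C r) k = psum r k.
Proof.
rewrite ch_std mulr_sumr; apply: eq_bigr => i _.
rewrite mulr_natl -(scaler_nat _ (_ : {mpoly rat[r]})) scalerA mulfV ?scale1r //.
by rewrite pnatr_eq0 -lt0n fact_gt0.
Qed.

Lemma std_pattern2 : ch_pattern2 (std C r) r%:R 1 0 1.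
Proof.
split.
- have := natr_mul_ch_std 0; rewrite fact0 mul1r => ->.
  rewrite /psum; under eq_bigr do rewrite expr0.
  by rewrite sumr_const card_ord mpolyC_nat.
- by have := natr_mul_ch_std 1; rewrite mul1r mpolyC1 mul1r.
rewrite mpolyC0 mpolyC1 mul0r mul1r add0r.
exact: (natr_mul_ch_std 2).
Qed.

Lemma std_pattern3 : ch_pattern3 (std C r) 0 0 1.
Proof.
rewrite /ch_pattern3 mpolyC0 mpolyC1 !mulr0 !mul0r mul1r !add0r.
exact: (natr_mul_ch_std 3).
Qed.

Lemma meval_psum (v : 'I_r -> rat) k : (psum r k).@[v] = \sum_i v i ^+ k.
Proof.
rewrite rmorph_sum; apply: eq_bigr => i _ /=.
by rewrite rmorphXn /= mevalXU.
Qed.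

(** Evaluate at [(1, -1, 0, ..., 0)], where the first power sum vanishes and the
    second does not. *)
Lemma d2_std_neq0 : (1 < r)%N -> d2 (std C r) != 0.
Proof.
move=> r1; have r0 : r%:R != 0 :> rat by rewrite pnatr_eq0 -lt0n ltnW.
pose i0 := Ordinal (ltnW r1); pose i1 := Ordinal r1.
pose v (i : 'I_r) : rat := if i == i0 then 1 else if i == i1 then - 1 else 0.
have sumv k : (0 < k)%N -> \sum_i v i ^+ k = 1 + (- 1) ^+ k.
  move=> k0; rewrite (bigD1 i0) // (bigD1 i1) //= big1 ?addr0.
    by rewrite /v eqxx expr1n.
  by move=> i /andP[i_0 i_1]; rewrite /v (negPf i_0) (negPf i_1) expr0n eqn0Ngt k0.
apply/eqP => /(congr1 (meval v)); rewrite (d2_pattern r0 std_pattern2).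
rewrite mevalB !mevalM !mevalC !meval_psum !sumv //.
rewrite expr1 subrr !mulr0 sqrrN expr1n sub0r mul1r mulVf => [/eqP|].
  by rewrite oppr_eq0 oner_eq0.
by rewrite pnatr_eq0.
Qed.

(** Evaluate at [(1, 1, -2, 0, ..., 0)], where the first power sum vanishes and
    the third does not. *)
Lemma d3_std_neq0 : (2 < r)%N -> d3 (std C r) != 0.
Proof.
move=> r2; have r0 : r%:R != 0 :> rat by rewrite pnatr_eq0 -lt0n ltnW // ltnW.
pose i0 := Ordinal (ltnW (ltnW r2)); pose i1 := Ordinal (ltnW r2).
pose i2 := Ordinal r2.
pose v (i : 'I_r) : rat :=
  if i == i0 then 1 else if i == i1 then 1 else if i == i2 then - 2%:R else 0.
have sumv k : (0 < k)%N -> \sum_i v i ^+ k = 2%:R + (- 2%:R) ^+ k.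
  move=> k0; rewrite (bigD1 i0) // (bigD1 i1) // (bigD1 i2) //= big1 ?addr0.
    by rewrite /v eqxx /= !expr1n; ring.
  move=> i /andP[/andP[i_0 i_1] i_2].
  by rewrite /v (negPf i_0) (negPf i_1) (negPf i_2) expr0n eqn0Ngt k0.
apply/eqP => /(congr1 (meval v)).
rewrite (d3_pattern r0 std_pattern2 std_pattern3) !mevalD !mevalM !mevalC.
rewrite !meval_psum !sumv // expr1 subrr.
rewrite !(mul0r, mulr0) !add0r => /eqP.
have -> : 2%:R + (- 2%:R) ^+ 3 = - 6%:R :> rat by ring.
by rewrite mulf_eq0 oppr_eq0 mul1r invr_eq0 !pnatr_eq0.
Qed.

End StandardRepresentation.

Section IrreducibleRepresentation.
Variables (C : numFieldType) (r : nat) (W : vectType C).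
Variables (rho : 'M[C]_r -> 'End(W)) (alpha : 'X_{1..r}).
Hypothesis rho_poly : polynomial_rep rho.
Hypothesis rho_irr : irreducible_rep rho.
Hypothesis rho_hw : has_highest_weight rho alpha.

Let N : rat := (\dim {: W})%:R.
Let x (i : 'I_r) : rat := (alpha i)%:R.

Let N_neq0 : N != 0.
Proof. by rewrite pnatr_eq0; case: rho_irr. Qed.

Section Moments.
Import VectorInternalTheory.
Variable Q : 'M[{mpoly C[r * r]}]_(dim W).
Hypothesis QE : matrix_repr rho Q.
Let value1 := repr_value1 rho_poly QE.
Let valueM := repr_valueM rho_poly QE.

Let linear_form (m : 'X_{1..r}) : {mpoly rat[r]} :=
  \sum_(i < r) (m i)%:R%:MP * 'X_i.

Lemma fact_mul_ch k : (k`!)%:R * ch rho k =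
  \sum_(m : 'X_{1..r < weight_bound Q})
    ((\rank (weight_proj Q m))%:R : rat)%:MP * linear_form m ^+ k.
Proof.
rewrite (ch_weight_proj rho_poly QE) mulr_sumr; apply: eq_bigr => m _.
rewrite -mpolyC_nat !mul_mpolyC scalerA mulrCA mulfV ?mulr1; last first.
  by rewrite pnatr_eq0 -lt0n fact_gt0.
by congr (_ *: _ ^+ _); apply: eq_bigr => i _; rewrite mul_mpolyC.
Qed.

Let weight_sumC f : (weight_sum Q f)%:MP = \sum_(m : 'X_{1..r < weight_bound Q})
  ((\rank (weight_proj Q m))%:R : rat)%:MP * (f m)%:MP :> {mpoly rat[r]}.
Proof. by rewrite rmorph_sum; apply: eq_bigr => m _; rewrite /= mpolyCM. Qed.

Lemma ch_degree0 : ch rho 0 = N%:MP.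
Proof.
have := fact_mul_ch 0; rewrite fact0 mul1r => ->.
rewrite /N dimvf -(weight_sum1 value1 valueM) [RHS]weight_sumC.
by apply: eq_bigr => m _; rewrite expr0 mpolyC1.
Qed.

Lemma ch_degree1 : ch rho 1 = \sum_i (moment1 Q i)%:MP * 'X_i.
Proof.
have := fact_mul_ch 1; rewrite mul1r => ->.
under [RHS]eq_bigr => i _ do rewrite weight_sumC mulr_suml.
rewrite exchange_big; apply: eq_bigr => m _ /=.
rewrite expr1 /linear_form mulr_sumr; apply: eq_bigr => i _.
by rewrite mulrA.
Qed.

Lemma ch_degree2 : 2%:R * ch rho 2 =
  \sum_i \sum_j (moment2 Q i j)%:MP * ('X_i * 'X_j).
Proof.
rewrite -[LHS]/((2`!)%:R * _) fact_mul_ch.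
under [RHS]eq_bigr => i _ do (under eq_bigr => j _ do
  rewrite weight_sumC mulr_suml; rewrite exchange_big /=).
rewrite exchange_big; apply: eq_bigr => m _ /=.
rewrite expr2 {1}/linear_form mulr_suml mulr_sumr; apply: eq_bigr => i _.
rewrite /linear_form !mulr_sumr; apply: eq_bigr => j _; rewrite mpolyCM.
ring.
Qed.

Lemma ch_degree3 : 6%:R * ch rho 3 =
  \sum_i \sum_j \sum_k (moment3 Q i j k)%:MP * ('X_i * 'X_j * 'X_k).
Proof.
rewrite -[LHS]/((3`!)%:R * _) fact_mul_ch.
under [RHS]eq_bigr => i _ do (under eq_bigr => j _ do (under eq_bigr => k _ do
  rewrite weight_sumC mulr_suml; rewrite exchange_big /=); rewrite exchange_big /=).
rewrite exchange_big; apply: eq_bigr => m _ /=.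
rewrite exprS {1}/linear_form mulr_suml mulr_sumr; apply: eq_bigr => i _.
rewrite expr2 {1}/linear_form mulr_suml !mulr_sumr; apply: eq_bigr => j _.
rewrite /linear_form !mulr_sumr; apply: eq_bigr => k _; rewrite !mpolyCM.
ring.
Qed.

(** The moments of an irreducible representation, with the linear equations that
    its central elements impose on them. *)
Lemma quadratic_data : (1 < r)%N -> exists n1 b d : rat,
  [/\ ch_pattern2 rho N n1 b d, r%:R * n1 = N * \sum_i x i,
    r%:R * b + d = (\sum_i x i) * n1,
    r%:R ^+ 2 * d + r%:R * b = N * casimir2_eigen x &
    forall i j, moment2 Q i j = b + d * (i == j)%:R].
Proof.
move=> r1; have [n1 n1P] := moment1_const value1 valueM.
have [b [d bdP]] := moment2_pattern value1 valueM r1.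
have [trZ cas2 cas3] := casimir_scalars rho_poly QE rho_irr rho_hw.
exists n1, b, d; split=> //.
- split; first exact: ch_degree0.
    rewrite ch_degree1 /psum mulr_sumr; apply: eq_bigr => i _.
    by rewrite n1P expr1.
  rewrite ch_degree2 -(sum_pattern2 (fun i : 'I_r => 'X_i)).
  apply: eq_bigr => i _; apply: eq_bigr => j _.
  by rewrite bdP mpolyCD mpolyCM mpolyC_nat.
- by rewrite (first_moment_relation valueM trZ n1P) /N dimvf.
- exact: (second_moment_relation valueM trZ n1P bdP (ltnW r1)).
by rewrite (casimir2_relation value1 valueM cas2 bdP) /N dimvf.
Qed.

Lemma cubic_data b d : (2 < r)%N ->
  (forall i j, moment2 Q i j = b + d * (i == j)%:R) -> exists A B E : rat,
  [/\ ch_pattern3 rho A B E, r%:R * A + 2%:R * B = (\sum_i x i) * b,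
    r%:R * B + E = (\sum_i x i) * d &
    r%:R ^+ 3 * ((E + d) / 2%:R) + 3%:R * r%:R ^+ 2 * B
      + r%:R * (A + (E - d) / 2%:R) = N * casimir3_eigen x].
Proof.
move=> r2 bdP; have [A [B [E ABEP]]] := moment3_pattern value1 valueM r2.
have [trZ cas2 cas3] := casimir_scalars rho_poly QE rho_irr rho_hw.
exists A, B, E; split.
- rewrite /ch_pattern3 ch_degree3 -(sum_pattern3 (fun i : 'I_r => 'X_i)).
  apply: eq_bigr => i _; apply: eq_bigr => j _; apply: eq_bigr => k _.
  by rewrite ABEP !(mpolyCD, mpolyCM) !mpolyC_nat.
- exact: (third_moment_relation valueM trZ bdP ABEP (ltnW r2)).
- exact: (third_moment_diag_relation valueM trZ bdP ABEP (ltnW r2)).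
by rewrite (casimir3_relation value1 valueM cas3 bdP ABEP) /N dimvf.
Qed.

End Moments.

(** After [d] is found by [solve_quadratic], proportionality to [d2] of the
    tautological representation still has to hold on the square of the first
    power sum; there it is the relation [key], a consequence of the Euler
    element acting by a scalar. *)
Lemma d2_irreducible : (1 < r)%N -> d2 rho =
  (delta_dot2 alpha / ((r%:R - 1) * (r%:R + 1)) * (N / r%:R)) *: d2 (std C r).
Proof.
move=> r1; have [Q QE] := exists_matrix_repr rho_poly.
have [n1 [b [d [chE n1E bE c2E _]]]] := quadratic_data QE r1.
have r0 : r%:R != 0 :> rat by rewrite pnatr_eq0 -lt0n ltnW.
have rm1 : r%:R - 1 != 0 :> rat by rewrite subr_eq0 pnatr_eq1 neq_ltn r1 orbT.
have rp1 : r%:R + 1 != 0 :> rat by rewrite natr1 pnatr_eq0.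
have -> : delta_dot2 alpha / ((r%:R - 1) * (r%:R + 1)) * (N / r%:R) = d.
  have := solve_quadratic n1E bE c2E.
  rewrite -[\sum_i x i]/(\sum_i x i ^+ 1) -delta_dot2_casimir => dE.
  have -> : d = r%:R * ((r%:R - 1) * (r%:R + 1)) * d /
    (r%:R * ((r%:R - 1) * (r%:R + 1))) by field; rewrite r0 rm1 rp1.
  by rewrite dE; field; rewrite r0 rm1 rp1.
have rb : r%:R * b = (\sum_i x i) * n1 - d by rewrite -bE addrK.
have key : n1 ^+ 2 - N * b = N * d / r%:R.
  apply: (mulfI r0).
  transitivity (n1 * (r%:R * n1) - N * (r%:R * b)); first by ring.
  by rewrite n1E rb; field.
have coef1 : (n1 ^+ 2 - N * b) / (2%:R * N) =
    d * ((1 ^+ 2 - r%:R * 0) / (2%:R * r%:R)).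
  by rewrite key; field; rewrite r0 N_neq0.
rewrite (d2_pattern N_neq0 chE) (d2_pattern r0 (std_pattern2 C r)) coef1.
by rewrite -mul_mpolyC mulrBr !(mulrA d%:MP) -!mpolyCM mul1r.
Qed.

(** As for [d2_irreducible]: the coefficient of the third power sum gives the
    scalar, [key1] and [key2] match the other two. *)
Lemma d3_irreducible : (2 < r)%N -> d3 rho =
  (delta_dot3 alpha / ((r%:R - 2%:R) * (r%:R - 1) * (r%:R + 1) * (r%:R + 2%:R))
    * (N / r%:R)) *: d3 (std C r).
Proof.
move=> r2; have [Q QE] := exists_matrix_repr rho_poly.
have [n1 [b [d [chE n1E bE c2E bdP]]]] := quadratic_data QE (ltnW r2).
have [A [B [E [chE3 AE BE c3E]]]] := cubic_data QE r2 bdP.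
have r0 : r%:R != 0 :> rat by rewrite pnatr_eq0 -lt0n ltnW // ltnW.
have rm1 : r%:R - 1 != 0 :> rat.
  by rewrite subr_eq0 pnatr_eq1 neq_ltn (ltnW r2) orbT.
have rm2 : r%:R - 2%:R != 0 :> rat.
  by rewrite subr_eq0 eqr_nat neq_ltn r2 orbT.
have rp1 : r%:R + 1 != 0 :> rat by rewrite natr1 pnatr_eq0.
have rp2 : r%:R + 2%:R != 0 :> rat by rewrite -natrD pnatr_eq0 addn2.
set S1 := \sum_i x i in n1E bE AE BE.
have -> : delta_dot3 alpha / ((r%:R - 2%:R) * (r%:R - 1) * (r%:R + 1)
    * (r%:R + 2%:R)) * (N / r%:R) = E.
  have := solve_cubic n1E bE c2E AE BE c3E.
  rewrite -[S1]/(\sum_i x i ^+ 1) -delta_dot3_casimir => EE.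
  set q := r%:R * _ in EE.
  have q0 : q != 0 by rewrite !mulf_neq0.
  have -> : E = q * E / q by rewrite mulrAC mulfV ?mul1r.
  by rewrite EE /q; field; rewrite r0 rm1 rm2 rp1 rp2.
have rb : r%:R * b = S1 * n1 - d by rewrite -bE addrK.
have rB : r%:R * B = S1 * d - E by rewrite -BE addrK.
have rA : r%:R * A = S1 * b - 2%:R * B by rewrite -AE addrK.
have key2 : N * B - n1 * d = - (N * E / r%:R).
  apply: (mulfI r0).
  transitivity (N * (r%:R * B) - (r%:R * n1) * d); first by ring.
  by rewrite rB n1E; field.
have key1 : 2%:R * n1 ^+ 3 - 3%:R * N * n1 * b + N ^+ 2 * A =
    2%:R * N ^+ 2 * E / r%:R ^+ 2.
  apply: (mulfI (expf_neq0 2 r0)).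
  transitivity (2%:R * n1 * (r%:R * n1) ^+ 2 - 3%:R * N * (r%:R * n1) * (r%:R * b)
    + N ^+ 2 * (r%:R * (r%:R * A))); first by ring.
  rewrite rA n1E; have -> : r%:R * (S1 * b - 2%:R * B) =
    S1 * (r%:R * b) - 2%:R * (r%:R * B) by ring.
  by rewrite rb rB; field.
have coef1 : (2%:R * n1 ^+ 3 - 3%:R * N * n1 * b + N ^+ 2 * A) / (6%:R * N ^+ 2) =
    E * ((2%:R * 1 ^+ 3 - 3%:R * r%:R * 1 * 0 + r%:R ^+ 2 * 0)
         / (6%:R * r%:R ^+ 2)).
  by rewrite key1; field; rewrite r0 N_neq0.
have coef2 : (N * B - n1 * d) / (2%:R * N) =
    E * ((r%:R * 0 - 1 * 1) / (2%:R * r%:R)).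
  by rewrite key2; field; rewrite r0 N_neq0.
rewrite (d3_pattern N_neq0 chE chE3).
rewrite (d3_pattern r0 (std_pattern2 C r) (std_pattern3 C r)) coef1 coef2.
by rewrite -mul_mpolyC !mulrDr !(mulrA E%:MP) -!mpolyCM mul1r.
Qed.

End IrreducibleRepresentation.

Theorem theorem3p1 (R : realType) (r : nat) (alpha : 'X_{1..r})
    (W : vectType R[i]) (rho : 'M[R[i]]_r -> 'End(W))
    (alpha_part : is_partition alpha)
    (rho_poly : polynomial_rep rho)
    (rho_irr : irreducible_rep rho)
    (rho_hw : has_highest_weight rho alpha) :
  ((2 <= r)%N -> forall f : rat,
     d2 rho = f *: d2 (std R[i] r) <->
     f = delta_dot2 alpha / ((r%:R - 1) * (r%:R + 1))
         * ((\dim {: W})%:R / r%:R))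
  /\
  ((3 <= r)%N -> forall f : rat,
     d3 rho = f *: d3 (std R[i] r) <->
     f = delta_dot3 alpha
           / ((r%:R - 2%:R) * (r%:R - 1) * (r%:R + 1) * (r%:R + 2%:R))
         * ((\dim {: W})%:R / r%:R)).
Proof.
have scale_inj (p : {mpoly rat[r]}) (u f : rat) :
    p != 0 -> u *: p = f *: p -> f = u.
  move=> p0 /eqP; rewrite -subr_eq0 -scalerBl scaler_eq0 (negPf p0) orbF.
  by rewrite subr_eq0 => /eqP.
split=> r_ge f.
  rewrite (d2_irreducible rho_poly rho_irr rho_hw r_ge); split=> [|-> //].
  exact/scale_inj/d2_std_neq0.
rewrite (d3_irreducible rho_poly rho_irr rho_hw r_ge); split=> [|-> //].
exact/scale_inj/d3_std_neq0.
Qed.
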